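(* Let $f\in\mathbb{F}_2[\mathbf{t}]$ be a polynomial of degree $2$, and let $\mathfrak{o}$ be the graph whose vertices are the type-$0$ vertices of $\Gamma(f)\backslash\mathfrak{t}$, with one edge between $u$ and $w$ for each type-$1$ vertex of $\Gamma(f)\backslash\mathfrak{t}$ adjacent to both $u$ and $w$. Then: if $f=\mathbf{t}(\mathbf{t}+1)$, $\mathfrak{o}$ is the complete bipartite graph $K_{3,3}$; if $f$ is a perfect square, $\mathfrak{o}$ is the $1$-skeleton of a cube; if $f=\mathbf{t}^2+\mathbf{t}+1$, $\mathfrak{o}$ is the Petersen graph.
   Context: $K=\mathbb{F}_2(\mathbf{t})$, $P$ the place at infinity, $K_P=\mathbb{F}_2((\mathbf{t}^{-1}))$, $\mathcal{O}_P=\mathbb{F}_2[[\mathbf{t}^{-1}]]$. $\mathfrak{t}$ is the Bruhat–Tits tree at $P$: vertices are maximal $\mathcal{O}_P$-orders in $\mathbb{M}_2(K_P)$, adjacent iff in some basis they are $\mathbb{M}_2(\mathcal{O}_P)$ and $\begin{pmatrix}\mathcal{O}_P&\mathbf{t}^{-1}\mathcal{O}_P\\ \mathbf{t}\mathcal{O}_P&\mathcal{O}_P\end{pmatrix}$; $\mathrm{GL}_2(K)$ acts by conjugation. $\Gamma(1)=\mathrm{GL}_2(\mathbb{F}_2[\mathbf{t}])$ and $\Gamma(f)=\{\begin{pmatrix}1+fa&fb\\ fc&1+fd\end{pmatrix}\in\Gamma(1): a,b,c,d\in\mathbb{F}_2[\mathbf{t}]\}$. For $n\ge0$ let $v_n$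 be the vertex $\begin{pmatrix}\mathcal{O}_P&\mathbf{t}^n\mathcal{O}_P\\ \mathbf{t}^{-n}\mathcal{O}_P&\mathcal{O}_P\end{pmatrix}$; every vertex of $\mathfrak{t}$ is $\Gamma(1)$-equivalent to exactly one $v_n$, and a vertex of $\mathfrak{t}$ or of $\Gamma(f)\backslash\mathfrak{t}$ is of type $n$ if it is (the image of a vertex) in the $\Gamma(1)$-orbit of $v_n$. *)

(* Defs.v *)
From HB Require Import structures.
From mathcomp Require Import all_boot all_order all_algebra.
From mathcomp Require Import boolp classical_sets functions.

Set Implicit Arguments.
Unset Strict Implicit.
Unset Printing Implicit Defensive.

Import GRing.Theory.
Local Open Scope classical_set_scope.
Local Open Scope ring_scope.

(* A wrapper around [nat -> F], so that the pointwise ring structure on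
   functions does not interfere with the convolution product. *)
Record pseries (F : Type) := PSeries { pscoef : nat -> F }.

HB.instance Definition _ (F : Type) := gen_eqMixin (pseries F).
HB.instance Definition _ (F : Type) := gen_choiceMixin (pseries F).

Section PowerSeries.
Variable F : fieldType.
Implicit Types u v w : pseries F.

Lemma pseriesP u v : pscoef u =1 pscoef v -> u = v.
Proof. by case: u v => [u] [v] /= /funext ->. Qed.

Definition ps0 : pseries F := PSeries (fun=> 0).
Definition psopp u := PSeries (fun n => - pscoef u n).
Definition psadd u v := PSeries (fun n => pscoef u n + pscoef v n).

Lemma psaddA : associative psadd.
Proof. by move=> u v w; apply: pseriesP => n /=; rewrite addrA. Qed.
Lemma psaddC : commutative psadd.
Proof. by move=> u v; apply: pseriesP => n /=; rewrite addrC. Qed.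
Lemma psadd0 : left_id ps0 psadd.
Proof. by move=> u; apply: pseriesP => n /=; rewrite add0r. Qed.
Lemma psaddN : left_inverse ps0 psopp psadd.
Proof. by move=> u; apply: pseriesP => n /=; rewrite addNr. Qed.

HB.instance Definition _ :=
  GRing.isZmodule.Build (pseries F) psaddA psaddC psadd0 psaddN.

Definition psconst (c : F) : pseries F :=
  PSeries (fun n => if n == 0%N then c else 0).
Definition psX : pseries F := PSeries (fun n => (n == 1%N)%:R).
Definition ps1 : pseries F := psconst 1.
Definition psmul u v : pseries F :=
  PSeries (fun n => \sum_(i < n.+1) pscoef u i * pscoef v (n - i)%N).

Definition pstrunc u n : {poly F} := \poly_(i < n.+1) pscoef u i.

Lemma coef_pstrunc u n i : (i <= n)%N -> (pstrunc u n)`_i = pscoef u i.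
Proof. by move=> le_in; rewrite coef_poly ltnS le_in. Qed.

Lemma pscoef_mul u v n i : (i <= n)%N ->
  pscoef (psmul u v) i = (pstrunc u n * pstrunc v n)`_i.
Proof.
move=> le_in; rewrite coefM /=; apply: eq_bigr => j _.
have le_ji : (j <= i)%N by rewrite -ltnS.
by rewrite !coef_pstrunc ?(leq_trans _ le_in) ?leq_subr.
Qed.

Lemma psmulC : commutative psmul.
Proof.
by move=> u v; apply: pseriesP => n; rewrite !(@pscoef_mul _ _ n) // mulrC.
Qed.

Lemma psmulA : associative psmul.
Proof.
move=> u v w; apply: pseriesP => n; rewrite !(@pscoef_mul _ _ n) //.
have -> : (pstrunc u n * pstrunc (psmul v w) n)`_n =
          (pstrunc u n * (pstrunc v n * pstrunc w n))`_n.
  rewrite !coefM; apply: eq_bigr => j _; congr (_ * _).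
  by rewrite coef_pstrunc ?leq_subr // (@pscoef_mul _ _ n) ?leq_subr.
have -> : (pstrunc (psmul u v) n * pstrunc w n)`_n =
          (pstrunc u n * pstrunc v n * pstrunc w n)`_n.
  rewrite !coefM; apply: eq_bigr => j _; congr (_ * _).
  have le_jn : (j <= n)%N by rewrite -ltnS.
  by rewrite coef_pstrunc // (@pscoef_mul _ _ n).
by rewrite mulrA.
Qed.

Lemma psmul1 : left_id ps1 psmul.
Proof.
move=> u; apply: pseriesP => n /=; rewrite big_ord_recl /= mul1r subn0.
by rewrite big1 ?addr0 // => i _; rewrite mul0r.
Qed.

Lemma psmulDl : left_distributive psmul psadd.
Proof.
move=> u v w; apply: pseriesP => n /=; rewrite -big_split /=.
by apply: eq_bigr => i _; rewrite mulrDl.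
Qed.

Lemma ps1_neq0 : ps1 != 0.
Proof.
apply/eqP => /(congr1 (fun u => pscoef u 0%N)) /= /eqP.
by rewrite oner_eq0.
Qed.

HB.instance Definition _ :=
  GRing.Zmodule_isComNzRing.Build (pseries F)
    psmulA psmulC psmul1 psmulDl ps1_neq0.

Definition psunit : {pred pseries F} := fun u => `[< exists v, v * u = 1 >].
Definition psinv u : pseries F :=
  if pselect (exists v, v * u = 1) is left uP then projT1 (cid uP) else u.

Lemma psmulV : {in psunit, left_inverse 1 psinv *%R}.
Proof.
move=> u /asboolP uU; rewrite /psinv; case: pselect => // uP.
by case: (cid uP).
Qed.
Lemma psunitPl u v : v * u = 1 -> psunit u.
Proof. by move=> vu1; apply/asboolP; exists v. Qed.
Lemma psinv_out : {in [predC psunit], psinv =1 id}.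
Proof.
by move=> u /asboolP uN; rewrite /psinv; case: pselect.
Qed.

HB.instance Definition _ :=
  GRing.ComNzRing_hasMulInverse.Build (pseries F) psmulV psunitPl psinv_out.

Lemma psneq0P u : u != 0 ->
  exists2 i, pscoef u i != 0 & forall j, (j < i)%N -> pscoef u j = 0.
Proof.
move=> u0; have exu : exists i, pscoef u i != 0.
  apply: contrapT => nex; move/eqP: u0; apply; apply: pseriesP => i /=.
  by apply/eqP; apply/negPn/negP => ui; apply: nex; exists i.
case: (ex_minnP exu) => i ui mini; exists i => // j lt_ji.
apply/eqP; apply: contraTT lt_ji => uj; rewrite -leqNgt; exact: mini.
Qed.

Lemma psmul_eq0 u v : u * v = 0 -> (u == 0) || (v == 0).
Proof.
move=> uv0; apply/norP => -[/psneq0P[i ui mini] /psneq0P[j vj minj]].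
have := congr1 (fun w => pscoef w (i + j)%N) uv0; rewrite /=.
have lti : (i < (i + j).+1)%N by rewrite ltnS leq_addr.
rewrite (bigD1 (Ordinal lti)) //= addKn big1 ?addr0 => [/eqP|k nk].
  by rewrite mulf_eq0 (negPf ui) (negPf vj).
case: (ltngtP k i) => [lt_ki|lt_ik|eq_ki].
- by rewrite mini // mul0r.
- by rewrite minj ?mulr0 // ltn_subLR ?ltn_add2r // -ltnS.
- by case/eqP: nk; apply: val_inj.
Qed.

HB.instance Definition _ :=
  GRing.ComUnitRing_isIntegral.Build (pseries F) psmul_eq0.

End PowerSeries.

(* The variable X of the power series stands for t^-1: [OP] is F_2[[t^-1]]
   and [KP], its field of fractions, is F_2((t^-1)). *)
Notation KP := {fraction (pseries 'F_2)}.

Definition OP : set KP := range (@tofrac (pseries 'F_2)).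

Definition tP : KP := (tofrac (psX 'F_2))^-1.

(* The embedding of F_2[t] in K_P, sending t to tP. *)
Definition poly_KP (p : {poly 'F_2}) : KP :=
  (map_poly (fun c => tofrac (psconst c)) p).[tP].

Definition OP_span (s : seq 'M[KP]_2) : set 'M[KP]_2 :=
  [set x | exists2 c : 'I_(size s) -> KP,
     forall i, OP (c i) & x = \sum_(i < size s) c i *: s`_i].

Definition is_lattice (D : set 'M[KP]_2) : Prop :=
  exists2 s : seq 'M[KP]_2, D = OP_span s & <<s>>%VS = fullv.

Definition is_order (D : set 'M[KP]_2) : Prop :=
  [/\ is_lattice D, D 1%:M & forall x y, D x -> D y -> D (x *m y)].

Definition is_max_order (D : set 'M[KP]_2) : Prop :=
  is_order D /\ forall E, is_order E -> D `<=` E -> E = D.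

Definition conjset (g : 'M[KP]_2) (D : set 'M[KP]_2) : set 'M[KP]_2 :=
  [set g *m x *m invmx g | x in D].

(* The order with rows (O_P, t^n O_P) and (t^-n O_P, O_P), for an integer n;
   in particular [std_order 0] is M_2(O_P). *)
Definition std_order (n : int) : set 'M[KP]_2 :=
  [set x | [/\ OP (x 0 0), exists2 a, OP a & x 0 1 = tP ^ n * a,
               exists2 a, OP a & x 1 0 = tP ^ (- n) * a & OP (x 1 1)]].

Definition tree_vertices : set (set 'M[KP]_2) := is_max_order.

Definition tree_adj (D E : set 'M[KP]_2) : Prop :=
  exists g : 'M[KP]_2, [/\ g \in unitmx,
    D = conjset g (std_order 0) & E = conjset g (std_order (- 1))].

Definition Gamma1 : set 'M[{poly 'F_2}]_2 := [set g | g \in unitmx].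

Definition Gamma (f : {poly 'F_2}) : set 'M[{poly 'F_2}]_2 :=
  [set g | Gamma1 g /\ exists a : 'M[{poly 'F_2}]_2, g = 1%:M + f *: a].

Definition act (g : 'M[{poly 'F_2}]_2) (D : set 'M[KP]_2) : set 'M[KP]_2 :=
  conjset (map_mx poly_KP g) D.

Definition orbit (f : {poly 'F_2}) (D : set 'M[KP]_2) : set (set 'M[KP]_2) :=
  [set act g D | g in Gamma f].

Definition has_type (n : nat) (D : set 'M[KP]_2) : Prop :=
  exists2 g, Gamma1 g & D = act g (std_order n%:Z).

Definition quot_vertices (f : {poly 'F_2}) : set (set (set 'M[KP]_2)) :=
  [set orbit f D | D in tree_vertices].

Definition quot_adj (u w : set (set 'M[KP]_2)) : Prop :=
  exists D E, [/\ u D, w E & tree_adj D E].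

Definition quot_type (f : {poly 'F_2}) (n : nat) : set (set (set 'M[KP]_2)) :=
  [set u | quot_vertices f u /\ exists2 D, u D & has_type n D].

(* The set of ends of an edge is a pair, or a singleton for a loop. *)
Record multigraph := MultiGraph {
  mg_vertex : Type;
  mg_edge : Type;
  mg_ends : mg_edge -> set mg_vertex }.

Definition mg_iso (G H : multigraph) : Prop :=
  exists (phi : mg_vertex G -> mg_vertex H) (psi : mg_edge G -> mg_edge H),
    [/\ bijective phi, bijective psi &
        forall e, mg_ends (psi e) = phi @` mg_ends e].

(* The graph with adjacency relation e, assumed symmetric and irreflexive. *)
Definition simple_graph (T : finType) (e : rel T) : multigraph :=
  @MultiGraph T
    {A : set T | exists x y, e x y /\ A = [set x; y]} (fun A => sval A).

Definition K33_rel : rel (bool * 'I_3) := fun x y => x.1 != y.1.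
Definition K33 := simple_graph K33_rel.

Definition cube_rel : rel {ffun 'I_3 -> bool} :=
  fun x y => #|[pred i | x i != y i]| == 1%N.
Definition cube := simple_graph cube_rel.

(* The Petersen graph as the Kneser graph K(5,2). *)
Definition petersen_rel : rel {A : {set 'I_5} | #|A| == 2%N} :=
  fun A B => [disjoint val A & val B]%B.
Definition petersen := simple_graph petersen_rel.

Definition overtex (f : {poly 'F_2}) : Type :=
  {u : set (set 'M[KP]_2) | quot_type f 0 u}.

(* One edge between u and w for each type-1 vertex x adjacent to both. When
   u = w this is only meant if x leads nowhere else: otherwise each x adjacent
   to u would produce a loop at u. *)
Definition oedge (f : {poly 'F_2}) : Type :=
  {p : set (overtex f) * set (set 'M[KP]_2) |
    quot_type f 1 p.2 /\
    exists u w : overtex f,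
      [/\ p.1 = [set u; w], quot_adj (sval u) p.2, quot_adj (sval w) p.2 &
          u <> w \/ forall z : overtex f, quot_adj (sval z) p.2 -> z = u]}.

Definition ograph (f : {poly 'F_2}) : multigraph :=
  @MultiGraph (overtex f) (oedge f) (fun e => (sval e).1).

(* Main.v *)
(* A type-0 (resp. type-1) vertex of the quotient is the Gamma(f)-orbit of g v_0
   (resp. g v_1) for some g in Gamma(1). The stabilizer of v_0 in Gamma(1) is
   GL_2(F_2), that of v_1 contains the upper unitriangular matrices with entry of
   degree at most 1, and the neighbors of v_1 of type 0 are v_0 and u v_0, where
   u is unitriangular with entry t. As f has degree 2 and
   SL_2(F_2[t]) -> SL_2(F_2[t]/f) is onto, the type-0 vertices are therefore the
   cosets of SL_2(F_2) in SL_2(F_2[t]/f), and the edges join g SL_2(F_2) and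
   g u SL_2(F_2). The statement is then a computation in three groups of order
   36, 48 and 60, made with an explicit invariant of the cosets in each case. *)

Require Import Defs.
From HB Require Import structures.
From mathcomp Require Import all_boot all_order all_algebra.
From mathcomp Require Import boolp classical_sets functions.
From mathcomp Require Import ring.

Set Implicit Arguments.
Unset Strict Implicit.
Unset Printing Implicit Defensive.

(* Importing [Defs] again lets its [orbit] shadow the one of [fingraph]. *)
Import Defs GRing.Theory.
Local Open Scope classical_set_scope.
Local Open Scope ring_scope.
Local Notation piP := (tofrac (psX 'F_2) : KP).

(** * The completion at infinity *)

(** Inclusions between orders are turned into degree bounds: t^-n p is integral exactly when deg p
    <= n. To bound the entries of g, a matrix unit E_kl is conjugated; the result has the entries
    (g^-1)_ik g_lj, and a nonzero (g^-1)_ik bounds row l of g. With det g = 1, such bounds yield the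
    stabilizer of v_0 and the neighbors of v_1. Since edges are counted by type-1 vertices, the
    graph could a priori have multiple edges, and two type-1 vertices with the same ends must be
    shown equal. If g and h give the same unordered pair of cosets, the finite computation finds h =
    g u_b modulo f with u_b unitriangular; the entry b lifts to degree at most 1, and u_b then fixes
    v_1. The order of the ends is immaterial because u, an involution, exchanges them. *)

Lemma pscoefD (F : fieldType) (u v : pseries F) n :
  pscoef (u + v) n = pscoef u n + pscoef v n.
Proof. by []. Qed.

Lemma pscoefXM (F : fieldType) (u : pseries F) n :
  pscoef (psX F * u) n = if n is m.+1 then pscoef u m else 0.
Proof.
rewrite /=; case: n => [|n]; first by rewrite big_ord1 mul0r.
rewrite !big_ord_recl /= mul0r add0r mul1r subSS subn0 big1 ?addr0 // => i _.
by rewrite mul0r.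
Qed.

Lemma pscoefXnM (F : fieldType) (u : pseries F) k n :
  pscoef (psX F ^+ k * u) n = if (k <= n)%N then pscoef u (n - k)%N else 0.
Proof.
elim: k n => [|k IHk] n; first by rewrite expr0 mul1r subn0.
rewrite exprS -mulrA pscoefXM; case: n => [//|n].
by rewrite IHk ltnS subSS.
Qed.

Lemma psX_neq0 (F : fieldType) : psX F != 0.
Proof.
apply/eqP => /(congr1 (fun u => pscoef u 1%N)) /= /eqP.
by rewrite oner_eq0.
Qed.

Lemma piP_neq0 : piP != 0.
Proof. by rewrite tofrac_eq0 psX_neq0. Qed.

Lemma tP_neq0 : tP != 0. Proof. by rewrite invr_eq0 piP_neq0. Qed.

Lemma OP_tofrac a : OP (tofrac a). Proof. by exists a. Qed.
Lemma OP0 : OP 0. Proof. by rewrite -[0]tofrac0; exact: OP_tofrac. Qed.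
Lemma OP1 : OP 1. Proof. by rewrite -[1]tofrac1; exact: OP_tofrac. Qed.
Lemma OPX : OP piP. Proof. exact: OP_tofrac. Qed.
Lemma OPD x y : OP x -> OP y -> OP (x + y).
Proof. by case=> a _ <- [b _ <-]; rewrite -tofracD; exact: OP_tofrac. Qed.
Lemma OPM x y : OP x -> OP y -> OP (x * y).
Proof. by case=> a _ <- [b _ <-]; rewrite -tofracM; exact: OP_tofrac. Qed.
Lemma OP_sum (I : Type) (r : seq I) (P : pred I) (F : I -> KP) :
  (forall i, P i -> OP (F i)) -> OP (\sum_(i <- r | P i) F i).
Proof. by move=> OF; elim/big_ind: _ => //; [exact: OP0 | exact: OPD]. Qed.

Definition constKP (c : 'F_2) : KP := tofrac (psconst c).

Lemma psconst_is_additive (F : fieldType) : zmod_morphism (@psconst F).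
Proof.
by move=> a b; apply: pseriesP => -[|n] /=; rewrite ?subr0.
Qed.
HB.instance Definition _ (F : fieldType) :=
  GRing.isZmodMorphism.Build F (pseries F) (@psconst F)
    (@psconst_is_additive F).

Lemma psconst_is_multiplicative (F : fieldType) : monoid_morphism (@psconst F).
Proof.
split=> // a b; apply: pseriesP => n /=.
rewrite big_ord_recl /= subn0 big1 ?addr0 => [|i _]; last by rewrite mul0r.
by case: n => [|n] //=; rewrite mulr0.
Qed.
HB.instance Definition _ (F : fieldType) :=
  GRing.isMonoidMorphism.Build F (pseries F) (@psconst F)
    (@psconst_is_multiplicative F).

HB.instance Definition _ := GRing.RMorphism.copy constKP
  (@tofrac (pseries 'F_2) \o @psconst 'F_2).

HB.instance Definition _ := GRing.RMorphism.copy poly_KP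
  (horner_eval tP \o map_poly constKP).

Lemma poly_KP_C c : poly_KP c%:P = constKP c.
Proof. by rewrite /poly_KP (map_polyC constKP) hornerC. Qed.

(** The reversal X^m p(1/X) of p, for a bound m on its degree. *)
Definition psrev (p : {poly 'F_2}) (m : nat) : pseries 'F_2 :=
  \sum_(i < m.+1) psX 'F_2 ^+ (m - i) * psconst p`_i.

Lemma poly_KP_rev (p : {poly 'F_2}) m : (size p <= m.+1)%N ->
  piP ^+ m * poly_KP p = tofrac (psrev p m).
Proof.
move=> szp; have szp' : (size (map_poly constKP p) <= m.+1)%N.
  exact: leq_trans (size_poly _ _) szp.
rewrite /poly_KP (horner_coef_wide _ szp') big_distrr rmorph_sum /=.
apply: eq_bigr => i _; rewrite coef_map /= tofracM tofracXn.
have le_im : (i <= m)%N by rewrite -ltnS.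
have -> : piP ^+ m = piP ^+ (m - i) * piP ^+ i by rewrite -exprD subnK.
by rewrite mulrCA exprVn mulfK ?expf_neq0 ?piP_neq0 // mulrC.
Qed.

(** If n < m = deg p, integrality of t^-n p would make the reversal X^m p(1/X) divisible by X, but
    its constant coefficient is the leading coefficient of p. *)
Lemma OP_poly_KP (p : {poly 'F_2}) n :
  OP (piP ^+ n * poly_KP p) <-> (size p <= n.+1)%N.
Proof.
split=> [|szp]; last by rewrite poly_KP_rev //; exact: OP_tofrac.
case=> u _ def_u; rewrite leqNgt; apply/negP => lt_n_p.
have szp : size p = (size p).-1.+1.
  by rewrite prednK // (leq_ltn_trans _ lt_n_p).
set m := (size p).-1 in szp.
have lt_nm : (n < m)%N by rewrite -ltnS -szp.
have := @poly_KP_rev p m; rewrite {1}szp leqnn => /(_ isT).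
rewrite -{1}(subnK (ltnW lt_nm)) exprD -mulrA -def_u -tofracXn -tofracM.
move/eqP; rewrite tofrac_eq => /eqP/(congr1 (fun v => pscoef v 0)).
rewrite pscoefXnM leqn0 subn_eq0 leqNgt lt_nm /= /psrev => /esym/eqP.
rewrite (big_morph (fun v => pscoef v 0) (id1 := 0) (op1 := +%R)) //.
rewrite big_ord_recr big1 ?add0r => [|i _].
  rewrite pscoefXnM -[nat_of_ord ord_max]/m subnn leqnn subnn /=.
  by rewrite add0r -[p`_m]/(lead_coef p) lead_coef_eq0 -size_poly_eq0 szp.
by rewrite pscoefXnM leqn0 subn_eq0 leqNgt /= ltn_ord.
Qed.

Lemma OP_poly_KP0 p : OP (poly_KP p) <-> (size p <= 1)%N.
Proof. by rewrite -OP_poly_KP expr0 mul1r. Qed.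

(** * Orders and conjugation *)

Lemma invmx_mul (R : comUnitRingType) n (g h : 'M[R]_n) :
  g \in unitmx -> h \in unitmx -> invmx (g *m h) = invmx h *m invmx g.
Proof.
move=> gU hU; have ghU : g *m h \in unitmx by rewrite unitmx_mul gU.
by rewrite -[RHS]mulmx1 -(mulmxV ghU) !mulmxA mulmxKV // mulVmx // mul1mx.
Qed.

Lemma conjsetP (g : 'M[KP]_2) D x : g \in unitmx ->
  conjset g D x <-> D (invmx g *m x *m g).
Proof.
move=> gU; split=> [[y Dy <-]|Dx].
  by rewrite !mulmxA (mulVmx gU) mul1mx -mulmxA (mulVmx gU) mulmx1.
exists (invmx g *m x *m g) => //.
by rewrite !mulmxA (mulmxV gU) mul1mx -mulmxA (mulmxV gU) mulmx1.
Qed.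

Lemma conjset1 D : conjset 1%:M D = D.
Proof.
by apply/seteqP; split=> x; rewrite conjsetP ?unitmx1 // invmx1 mul1mx mulmx1.
Qed.

Lemma conjsetM (g h : 'M[KP]_2) D : g \in unitmx -> h \in unitmx ->
  conjset (g *m h) D = conjset g (conjset h D).
Proof.
move=> gU hU; have ghU : g *m h \in unitmx by rewrite unitmx_mul gU.
by apply/seteqP; split=> x; rewrite !conjsetP // (invmx_mul gU hU) !mulmxA.
Qed.

Lemma conjset_sub (g : 'M[KP]_2) D E : D `<=` E -> conjset g D `<=` conjset g E.
Proof. by move=> DE _ [y Dy <-]; exists y => //; exact: DE. Qed.

(** Coefficients indexed by [nat] are insensitive to a change of [size s] along an equation such as
    [size_map]. *)
Lemma OP_spanP (s : seq 'M[KP]_2) x :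
  OP_span s x <->
  exists2 c : nat -> KP, forall i, OP (c i) & x = \sum_(i < size s) c i *: s`_i.
Proof.
split=> -[c Oc ->]; last by exists (fun i => c i).
exists (fun i => if insub i is Some j then c j else 0).
  by move=> i; case: insubP => // *; exact: OP0.
by apply: eq_bigr => i _; rewrite valK.
Qed.

Lemma OP_span_map (f : {linear 'M[KP]_2 -> 'M[KP]_2}) s :
  OP_span (map f s) = [set f x | x in OP_span s].
Proof.
apply/seteqP; split=> [x /OP_spanP[c Oc ->]|_ [_ /OP_spanP[c Oc ->] <-]].
  exists (\sum_(i < size s) c i *: s`_i); first by apply/OP_spanP; exists c.
  rewrite linear_sum size_map; apply: eq_bigr => i _.
  by rewrite linearZ (nth_map 0).
apply/OP_spanP; exists c => //; rewrite linear_sum size_map.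
by apply: eq_bigr => i _; rewrite linearZ (nth_map 0).
Qed.

Section Conj.
Variables (g : 'M[KP]_2) (gU : g \in unitmx).

Definition conj_mx (x : 'M[KP]_2) : 'M[KP]_2 := g *m x *m invmx g.

Lemma conj_mx_is_linear : linear conj_mx.
Proof.
by move=> a x y; rewrite /conj_mx mulmxDr mulmxDl -scalemxAr -scalemxAl.
Qed.
HB.instance Definition _ :=
  GRing.isLinear.Build KP 'M[KP]_2 'M[KP]_2 _ conj_mx conj_mx_is_linear.

Lemma conj_mxM x y : conj_mx (x *m y) = conj_mx x *m conj_mx y.
Proof. by rewrite /conj_mx !mulmxA (mulmxKV gU). Qed.

Lemma lattice_conjset D : is_lattice D -> is_lattice (conjset g D).
Proof.
case=> s -> span_s; exists (map conj_mx s); first by rewrite OP_span_map.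
have -> : map conj_mx s = map (linfun conj_mx) s.
  by apply: eq_map => x; rewrite lfunE.
rewrite -limg_span span_s; apply/eqP; rewrite eqEsubv subvf /=.
apply/subvP => x _; apply/memv_imgP; exists (invmx g *m x *m g).
  exact: memvf.
by rewrite lfunE /= /conj_mx !mulmxA (mulmxV gU) mul1mx (mulmxK gU).
Qed.

Lemma order_conjset D : is_order D -> is_order (conjset g D).
Proof.
case=> latD D1 DM; split; first exact: lattice_conjset.
  by rewrite conjsetP // mulmx1 (mulVmx gU).
move=> _ _ [x Dx <-] [y Dy <-]; exists (x *m y); first exact: DM.
exact: conj_mxM.
Qed.
End Conj.

Lemma max_order_conjset g D : g \in unitmx ->
  is_max_order D -> is_max_order (conjset g D).
Proof.
move=> gU [oD mD]; have gVU : invmx g \in unitmx by rewrite unitmx_inv.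
split=> [|E oE DE]; first exact: (order_conjset gU oD).
have -> : E = conjset g (conjset (invmx g) E).
  by rewrite -(conjsetM _ gU gVU) (mulmxV gU) conjset1.
rewrite (mD _ (order_conjset gVU oE)) //.
rewrite -{1}[D]conjset1 -(mulVmx gU) (conjsetM _ gVU gU); exact: conjset_sub.
Qed.

Lemma ord2P (P : 'I_2 -> Prop) : P 0 -> P 1 -> forall i, P i.
Proof.
move=> P0 P1 i; case: (unliftP 0 i) => [j ->|->] //.
by rewrite (_ : lift 0 j = 1) //; apply: val_inj; rewrite ord1.
Qed.

Lemma mul2E (R : pzSemiRingType) (x y : 'M[R]_2) i j :
  (x *m y) i j = x i 0 * y 0 j + x i 1 * y 1 j.
Proof.
by rewrite mxE big_ord_recl big_ord1 (_ : lift 0 0 = 1) //; apply: val_inj.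
Qed.

Lemma std_orderP n x : std_order n x <->
  [/\ OP (x 0 0), OP (tP ^ (- n) * x 0 1), OP (tP ^ n * x 1 0) & OP (x 1 1)].
Proof.
have tPn m : tP ^ m != 0 by rewrite expfz_neq0 ?tP_neq0.
split=> [[O00 [a Oa ->] [b Ob ->] O11]|[O00 O01 O10 O11]].
  by split=> //; rewrite -invr_expz ?(mulKf (tPn n)) ?(mulVKf (tPn n)).
split=> //; [exists (tP ^ (- n) * x 0 1)|exists (tP ^ n * x 1 0)] => //.
  by rewrite -invr_expz (mulVKf (tPn n)).
by rewrite -invr_expz (mulKf (tPn n)).
Qed.

Lemma std0P x : std_order 0 x <-> forall i j, OP (x i j).
Proof.
rewrite std_orderP oppr0 !expr0z !mul1r; split=> [[O00 O01 O10 O11]|//].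
by apply: ord2P; apply: ord2P.
Qed.

Lemma std1P x : std_order 1 x <->
  [/\ OP (x 0 0), OP (piP * x 0 1), OP (tP * x 1 0) & OP (x 1 1)].
Proof. by rewrite std_orderP exprN1 expr1z invrK. Qed.

Lemma stdN1P x : std_order (- 1) x <->
  [/\ OP (x 0 0), OP (tP * x 0 1), OP (piP * x 1 0) & OP (x 1 1)].
Proof. by rewrite std_orderP opprK exprN1 expr1z invrK. Qed.

(** * Invertible series and integrality in K_P *)

Lemma psfactorX (F : fieldType) (u : pseries F) k :
  (forall j, (j < k)%N -> pscoef u j = 0) ->
  u = psX F ^+ k * PSeries (fun n => pscoef u (n + k)).
Proof.
move=> u0; apply: pseriesP => n; rewrite pscoefXnM.
by case: leqP => [le_kn|/u0//] /=; rewrite subnK.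
Qed.

(* The inverse of 1 - X w is the X-adic limit of the geometric sums. *)
Lemma ps_geometric_inv (F : fieldType) (w : pseries F) :
  exists v, v * (1 - psX F * w) = 1.
Proof.
set x := psX F * w; pose S N := \sum_(k < N) x ^+ k.
have coefS N n : (n < N)%N -> pscoef (S N) n = pscoef (S n.+1) n.
  elim: N => // N IHN; rewrite ltnS leq_eqVlt => /predU1P[->//|lt_nN].
  rewrite /S big_ord_recr pscoefD exprMn pscoefXnM leqNgt lt_nN addr0.
  exact: IHN.
exists (PSeries (fun n => pscoef (S n.+1) n)); apply: pseriesP => n.
have -> : pscoef (PSeries (fun n => pscoef (S n.+1) n) * (1 - x)) n =
          pscoef (S n.+1 * (1 - x)) n.
  apply: eq_bigr => i _; congr (_ * _) => /=.
  by rewrite -(coefS n.+1) // ltn_ord.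
rewrite mulrC -[1 - x]opprB mulNr -subrX1 opprB pscoefD exprMn.
by rewrite -mulrN pscoefXnM ltnn addr0.
Qed.

Lemma ps_inv (F : fieldType) (u : pseries F) :
  pscoef u 0 = 1 -> exists v, v * u = 1.
Proof.
move=> u0.
have [v uv1] := ps_geometric_inv (PSeries (fun n => - pscoef u n.+1)).
exists v; rewrite -uv1; congr (_ * _); apply: pseriesP => n.
rewrite pscoefD -mulrN pscoefXM; case: n => [|n] /=; first by rewrite addr0.
by rewrite add0r opprK.
Qed.

Lemma fraction_split (R : idomainType) (x : {fraction R}) :
  exists2 b, b != 0 & exists a, x = tofrac a / tofrac b.
Proof.
elim/quotW: x => x; exists \d_x; first exact: denom_ratioP.
exists \n_x.
apply: (canRL (mulfK _)); first by rewrite tofrac_eq0 denom_ratioP.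
(* The equation x * denominator = numerator between classes is checked on representatives, where it
   is a cross-multiplication. *)
unlock FracField.tofrac; rewrite -[LHS]FracField.pi_mul; apply/eqmodP => /=.
rewrite FracField.equivfE /FracField.mulf.
rewrite !numden_Ratio ?mulf_neq0 ?oner_eq0 ?denom_ratioP //.
by rewrite !mulr1 mulrC.
Qed.

Lemma F2P (a : 'F_2) : a = 0 \/ a = 1.
Proof. by move: a; apply: ord2P; [left | right]. Qed.

(** Over F_2 the first nonzero coefficient is 1, which is the constant term that [ps_inv] asks of
    the cofactor. *)
Lemma psfactor (u : pseries 'F_2) : u != 0 ->
  exists k, exists2 v, u = psX 'F_2 ^+ k * v & exists w, w * v = 1.
Proof.
case/psneq0P => k uk mink; exists k.
exists (PSeries (fun n => pscoef u (n + k))); first exact: psfactorX.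
by apply: ps_inv => /=; case: (F2P (pscoef u k)) uk => ->; rewrite ?eqxx.
Qed.

(** The identity behind the second case of [OP_dichotomy], over an arbitrary field so that [field]
    meets only variables. *)
Lemma divf_cancel_cross (K : fieldType) (a b c d : K) :
  a != 0 -> b != 0 -> c != 0 -> d != 0 ->
  c * a / (d * c * b) * (d * (b / a)) = 1.
Proof. by move=> a0 b0 c0 d0; field; rewrite a0 b0 c0 d0. Qed.

Lemma divf_XnM (K : fieldType) (x a b : K) i j : x != 0 -> b != 0 ->
  x ^+ (i + j) * a / (x ^+ j * b) = x ^+ i * a / b.
Proof.
move=> x0 b0; rewrite exprD; have: x ^+ j != 0 by rewrite expf_neq0.
by move: (x ^+ j) (x ^+ i) => u v u0; field; rewrite u0 b0.
Qed.

(** A nonzero y is X^i a / (X^j b) with invertible series a and b, and the two cases are j <= i and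
    i < j. This plays the role of the valuation: the inverse of a non-integral element lies in the
    maximal ideal. *)
Lemma OP_dichotomy (y : KP) : OP y \/ exists2 z, OP z & y * (piP * z) = 1.
Proof.
have tofrac_inv (u v : pseries 'F_2) : v * u = 1 ->
    (tofrac u)^-1 = tofrac v :> KP.
  move=> vu; apply: mulr1_eq.
  by rewrite -tofracM mulrC vu tofrac1.
have tofrac_neq0 (u v : pseries 'F_2) : v * u = 1 -> tofrac u != 0 :> KP.
  move=> vu; rewrite tofrac_eq0; apply: contra_eq_neq vu => ->.
  by rewrite mulr0 eq_sym oner_eq0.
have [b b0 [a ->]] := fraction_split y.
have [->|a0] := eqVneq a 0; first by left; rewrite tofrac0 mul0r; exact: OP0.
have [i [a' -> [a'' a'V]]] := psfactor a0.
have [j [b' -> [b'' b'V]]] := psfactor b0.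
rewrite !tofracM !tofracXn; have [le_ji|lt_ij] := leqP j i.
  left; rewrite -(subnK le_ji) divf_XnM ?piP_neq0 ?(tofrac_neq0 _ _ b'V) //.
  rewrite (tofrac_inv _ _ b'V) -tofracXn.
  exact: (OPM (OPM (OP_tofrac _) (OP_tofrac _)) (OP_tofrac _)).
right; exists (piP ^+ (j - i).-1 * (tofrac b' * tofrac a'')).
  by rewrite -tofracXn -!tofracM; exact: OP_tofrac.
rewrite [piP * _]mulrA -exprS prednK ?subn_gt0 // -(tofrac_inv _ _ a'V).
have def_j : piP ^+ j = piP ^+ (j - i) * piP ^+ i.
  by rewrite -exprD subnK // ltnW.
rewrite def_j; have: piP ^+ (j - i) != 0 by rewrite expf_neq0 ?piP_neq0.
have: piP ^+ i != 0 by rewrite expf_neq0 ?piP_neq0.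
move: (tofrac_neq0 _ _ a'V) (tofrac_neq0 _ _ b'V).
exact: (@divf_cancel_cross KP).
Qed.

(** If y is not integral, then y piP z = 1 for an integral z, and c = (c y^n) (piP z)^n is divisible
    by X^n for every n > 0, which forces c = 0. *)
Lemma OP_completely_integral (c y : KP) :
  c != 0 -> (forall n, OP (c * y ^+ n)) -> OP y.
Proof.
move=> c0 Ocy; have [//|[z [w _ <-] yz]] := OP_dichotomy y.
have [c' _ def_c] := Ocy 0; rewrite mulr1 in def_c.
case/eqP: c0; rewrite -def_c (_ : c' = 0) ?tofrac0 //.
apply: pseriesP => n; have [d _ def_d] := Ocy n.+1.
have: tofrac c' = tofrac (psX 'F_2 ^+ n.+1 * (w ^+ n.+1 * d)).
  rewrite def_c mulrA -exprMn !tofracM tofracXn tofracM def_d mulrC -mulrA.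
  by rewrite -exprMn yz expr1n mulr1.
by move/eqP; rewrite tofrac_eq => /eqP->; rewrite pscoefXnM ltnn.
Qed.

Lemma common_denominator (s : seq KP) :
  exists c : KP, [/\ c != 0, OP c & forall x, x \in s -> OP (c * x)].
Proof.
elim: s => [|x s [c [c0 Oc IHs]]].
  by exists 1; split; [exact: oner_neq0 | exact: OP1 | by []].
have [b b0 [a def_x]] := fraction_split x.
have bF0 : tofrac b != 0 :> KP by rewrite tofrac_eq0.
exists (c * tofrac b); split=> [||y]; first exact: mulf_neq0.
  exact: (OPM Oc (OP_tofrac b)).
rewrite inE => /predU1P[->|sy].
  rewrite def_x -mulrA [X in _ * X]mulrC (divfK bF0).
  exact: (OPM Oc (OP_tofrac a)).
by rewrite mulrAC; exact: (OPM (IHs _ sy) (OP_tofrac b)).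
Qed.

(** * Matrix units and the maximality of M_2(O_P) *)

Lemma mul_delta_delta (R : comPzRingType) (x : 'M[R]_2) (i j k l : 'I_2) :
  delta_mx k i *m x *m delta_mx j l = x i j *: delta_mx k l.
Proof.
apply/matrixP => a b; rewrite !(mul2E, mxE).
move: i j; apply: ord2P; apply: ord2P; rewrite /= ?(andbT, andbF);
  case: (a == k); case: (b == l);
  by rewrite /= ?mul1r ?mul0r ?mulr1 ?mulr0 ?addr0 ?add0r.
Qed.

Lemma mul_mx_delta (R : comPzRingType) (x y : 'M[R]_2) (i j k l : 'I_2) :
  (x *m delta_mx k l *m y) i j = x i k * y l j.
Proof.
rewrite !(mul2E, mxE).
by move: k l; apply: ord2P; apply: ord2P;
  rewrite /= ?(mul0r, mulr0, mulr1, addr0, add0r).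
Qed.

Lemma sum4 (V : nmodType) (F : nat -> V) :
  \sum_(i < 4) F i = F 0 + F 1 + F 2 + F 3.
Proof. by rewrite !big_ord_recr big_ord0 /= add0r. Qed.

Definition mx_units : seq 'M[KP]_2 :=
  [:: delta_mx 0 0; delta_mx 0 1; delta_mx 1 0; delta_mx 1 1].

Lemma sum_mx_units (c : nat -> KP) :
  \sum_(i < size mx_units) c i *: mx_units`_i =
  \matrix_(i, j) c (2 * i + j)%N.
Proof.
rewrite (sum4 (fun i => c i *: mx_units`_i)) /=; apply/matrixP.
by apply: ord2P; apply: ord2P; rewrite !mxE /= !mulr0 mulr1 ?addr0 ?add0r.
Qed.

Lemma std0_span : std_order 0 = OP_span mx_units.
Proof.
apply/seteqP; split=> x.
  move/std0P=> Ox; apply/OP_spanP.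
  exists (nth 0 [:: x 0 0; x 0 1; x 1 0; x 1 1]).
    by case=> [|[|[|[|i]]]] //=; rewrite nth_nil; exact: OP0.
  rewrite sum_mx_units; apply/matrixP.
  by apply: ord2P; apply: ord2P; rewrite mxE.
case/OP_spanP => c Oc ->; apply/std0P => i j.
by rewrite sum_mx_units mxE.
Qed.

Lemma std0_order : is_order (std_order 0).
Proof.
split.
- exists mx_units; first exact: std0_span.
  apply/eqP; rewrite eqEsubv subvf /=; apply/subvP => x _.
  pose c := nth 0 [:: x 0 0; x 0 1; x 1 0; x 1 1].
  have -> : x = \sum_(i < size mx_units) c i *: mx_units`_i.
    rewrite sum_mx_units; apply/matrixP.
    by apply: ord2P; apply: ord2P; rewrite mxE.
  by apply: rpred_sum => i _; apply: rpredZ; apply: memv_span; exact: mem_nth.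
- by apply/std0P => i j; rewrite mxE; case: eqP => _; [exact: OP1 | exact: OP0].
move=> x y /std0P Ox /std0P Oy; apply/std0P => i j.
by rewrite mul2E; apply: OPD; apply: OPM.
Qed.

(** An order E above M_2(O_P) contains E_0i x E_j0 = y E_00 for each of its elements x and each
    entry y = x_ij, hence all y^n E_00. As E is spanned by finitely many matrices, the powers of y
    have a common denominator, and y is integral. *)
Lemma std0_max_order : is_max_order (std_order 0).
Proof.
split=> [|E [[s def_E _] _ EM] E0]; first exact: std0_order.
apply/seteqP; split=> // x Ex; apply/std0P => i j; set y := x i j.
have E_pow n : E (y ^+ n *: delta_mx 0 0).
  elim: n => [|n IHn].
    rewrite scale1r; apply: E0; apply/std0P => k l.
    by rewrite mxE; case: andP => _; [exact: OP1 | exact: OP0].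
  have Ed (k l : 'I_2) : E (delta_mx k l).
    apply: E0; apply/std0P => k' l'.
    by rewrite mxE; case: andP => _; [exact: OP1 | exact: OP0].
  have -> : y ^+ n.+1 *: delta_mx 0 0 =
      (y ^+ n *: delta_mx 0 0) *m ((delta_mx 0 i : 'M_2) *m x *m delta_mx j 0)
      :> 'M_2.
    rewrite mul_delta_delta -scalemxAl -scalemxAr mul_delta_mx.
    by rewrite scalerA -exprSr.
  exact: (EM _ _ IHn (EM _ _ (EM _ _ (Ed 0 i) Ex) (Ed j 0))).
have [c [c0 _ Oc]] := common_denominator [seq z 0 0 | z : 'M[KP]_2 <- s].
apply: (OP_completely_integral c0) => n; have := E_pow n.
rewrite def_E => /OP_spanP[d Od] /(congr1 (fun z : 'M_2 => z 0 0)).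
rewrite !mxE mulr1 => ->; rewrite summxE mulr_sumr; apply: OP_sum => k _.
rewrite mxE mulrCA; apply: OPM => //; apply: Oc.
by apply: map_f; exact: mem_nth.
Qed.

(** * Stabilizers and neighbors *)

Lemma invmx_unique (R : comUnitRingType) n (g h : 'M[R]_n) :
  h *m g = 1%:M -> invmx g = h.
Proof.
move=> hg1; have [_ gU] := mulmx1_unit hg1.
by rewrite -[LHS]mul1mx -hg1 mulmxK.
Qed.

Lemma unit_col (R : comUnitRingType) n (g : 'M[R]_n.+1) k :
  g \in unitmx -> exists i, g i k != 0.
Proof.
move=> gU; apply: contrapT => nex; have /matrixP/(_ k k) := mulVmx gU.
rewrite !mxE eqxx big1 => [/eqP|i _]; first by rewrite eq_sym oner_eq0.
suff -> : g i k = 0 by rewrite mulr0.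
by apply/eqP/negPn/negP => gik; apply: nex; exists i.
Qed.

Lemma leq_size_mul (R : idomainType) (p q : {poly R}) n :
  p != 0 -> (size (p * q)%R <= n)%N -> (size q <= n)%N.
Proof.
move=> p0; have [->|q0] := eqVneq q 0; first by rewrite mulr0.
rewrite size_mul //; apply: leq_trans.
by rewrite -(prednK (_ : 0 < size p)%N) ?size_poly_gt0 // addSn leq_addl.
Qed.

Lemma map_mx_rmorph_unit (R S : comUnitRingType) (f : {rmorphism R -> S}) n
  (g : 'M[R]_n) : g \in unitmx -> map_mx f g \in unitmx.
Proof. by rewrite !unitmxE det_map_mx; exact: rmorph_unit. Qed.

Lemma invmx_map_mx_rmorph (R S : comUnitRingType) (f : {rmorphism R -> S}) n
  (g : 'M[R]_n) : g \in unitmx -> invmx (map_mx f g) = map_mx f (invmx g).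
Proof.
by move=> gU; apply: invmx_unique; rewrite -map_mxM (mulVmx gU) map_mx1.
Qed.

Section Action.
Implicit Types (g h a : 'M[{poly 'F_2}]_2).

Lemma map_poly_KP_unit g : g \in unitmx -> map_mx poly_KP g \in unitmx.
Proof. exact: map_mx_rmorph_unit. Qed.

Lemma invmx_poly_KP g : g \in unitmx ->
  invmx (map_mx poly_KP g) = map_mx poly_KP (invmx g).
Proof. exact: invmx_map_mx_rmorph. Qed.

Lemma actP g D x : g \in unitmx ->
  act g D x <-> D (map_mx poly_KP (invmx g) *m x *m map_mx poly_KP g).
Proof.
by move=> gU; rewrite /act conjsetP ?map_poly_KP_unit // invmx_poly_KP.
Qed.

Lemma actM g h D : g \in unitmx -> h \in unitmx ->
  act (g *m h) D = act g (act h D).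
Proof.
by move=> gU hU; rewrite /act map_mxM conjsetM ?map_poly_KP_unit.
Qed.

Lemma act1 D : act 1%:M D = D.
Proof. by rewrite /act map_mx1 conjset1. Qed.

Lemma actK g D : g \in unitmx -> act (invmx g) (act g D) = D.
Proof. by move=> gU; rewrite -actM ?unitmx_inv // mulVmx // act1. Qed.

(** The matrix g^-1 E_kl g is column k of g^-1 times row l of g. All bounds on the entries of g come
    from here. *)
Lemma act_delta g D k l c : g \in unitmx -> act g D (c *: delta_mx k l) ->
  D (\matrix_(i, j) (c * poly_KP (invmx g i k * g l j))).
Proof.
move=> gU /(actP _ _ gU); congr (D _); apply/matrixP => i j.
by rewrite -scalemxAr -scalemxAl [LHS]mxE mul_mx_delta !mxE rmorphM.
Qed.

Lemma std0_delta k l : std_order 0 (delta_mx k l).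
Proof.
by apply/std0P => i j; rewrite mxE; case: andP => _; [exact: OP1 | exact: OP0].
Qed.

(** For E_0l, the polynomials (g^-1)_i0 g_lj are integral, hence constant; an i with (g^-1)_i0
    nonzero then makes g_lj constant. *)
Lemma stab_std0 g l j :
  g \in unitmx -> std_order 0 `<=` act g (std_order 0) -> (size (g l j) <= 1)%N.
Proof.
move=> gU sub0; have [i b0] := unit_col 0 (etrans (unitmx_inv g) gU).
have /sub0 := std0_delta 0 l; rewrite -[delta_mx _ _]scale1r.
move/(act_delta gU)/std0P/(_ i j); rewrite mxE mul1r => /OP_poly_KP0.
exact: leq_size_mul.
Qed.

Lemma std1_E01 : std_order 1 (tP *: delta_mx 0 1).
Proof.
apply/std1P; rewrite !mxE !mulr0 mulr1 mulfV ?piP_neq0 //.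
by split; [exact: OP0 | exact: OP1 | exact: OP0 | exact: OP0].
Qed.

Lemma std1_E00 : std_order 1 (delta_mx 0 0).
Proof.
apply/std1P; rewrite !mxE !mulr0.
by split; [exact: OP1 | exact: OP0 | exact: OP0 | exact: OP0].
Qed.

(* Adjacency gives [t^-1 v_1 `<=` a v_0]; the bounds are what this inclusion
   means for the elements [t E_01] and [E_00] of [v_1]. *)
Lemma adj_bound a :
  a \in unitmx -> tree_adj (act a (std_order 0)) (std_order 1) ->
  forall j, (size (a 1 j)%R <= 1)%N /\ (size (a 0 j)%R <= 2)%N.
Proof.
move=> aU [k [kU def_a def_1]] j.
have [i b0] := unit_col 0 (etrans (unitmx_inv a) aU).
have sub_a y : std_order 1 y -> act a (std_order 0) (piP *: y).
  rewrite def_1 def_a => -[x x0 <-]; exists (piP *: x).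
    case/stdN1P: x0 => O00 O01 O10 O11; apply/std0P.
    apply: ord2P; apply: ord2P; rewrite mxE.
    - exact: (OPM OPX O00).
    - rewrite (_ : piP * x 0 1 = piP ^+ 2 * (tP * x 0 1)).
        exact: (OPM (OPM OPX OPX) O01).
      by rewrite mulrA [piP ^+ 2]expr2 (mulfK piP_neq0).
    - exact: O10.
    - exact: (OPM OPX O11).
  by rewrite -scalemxAr -scalemxAl.
split.
  have /sub_a := std1_E01.
  rewrite scalerA (mulfV piP_neq0).
  move/(act_delta aU)/std0P/(_ i j).
  by rewrite mxE mul1r => /OP_poly_KP0; exact: leq_size_mul.
have /(act_delta aU)/std0P/(_ i j) := sub_a _ std1_E00.
rewrite mxE -[piP]expr1 => /OP_poly_KP.
exact: leq_size_mul.
Qed.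
End Action.

(** * Constant and unitriangular matrices, and the neighbors of v_1 *)

Definition mx22 (R : Type) (a b c d : R) : 'M[R]_2 :=
  \matrix_(i, j) if i == 0 then if j == 0 then a else b
                 else if j == 0 then c else d.

Lemma mx22_eta (R : Type) (x : 'M[R]_2) :
  x = mx22 (x 0 0) (x 0 1) (x 1 0) (x 1 1).
Proof. by apply/matrixP; apply: ord2P; apply: ord2P; rewrite mxE. Qed.

Lemma mx22M (R : pzSemiRingType) (a b c d a' b' c' d' : R) :
  mx22 a b c d *m mx22 a' b' c' d' =
  mx22 (a * a' + b * c') (a * b' + b * d') (c * a' + d * c') (c * b' + d * d').
Proof. by apply/matrixP; apply: ord2P; apply: ord2P; rewrite mul2E !mxE. Qed.

Lemma mx22_1 (R : pzSemiRingType) : 1%:M = mx22 1 0 0 1 :> 'M[R]_2.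
Proof. by rewrite [LHS]mx22_eta !mxE. Qed.

Lemma map_mx22 (R S : Type) (f : R -> S) a b c d :
  map_mx f (mx22 a b c d) = mx22 (f a) (f b) (f c) (f d).
Proof. by rewrite [LHS]mx22_eta !mxE. Qed.

Lemma det_mx22 (R : comPzRingType) (x : 'M[R]_2) :
  \det x = x 0 0 * x 1 1 - x 0 1 * x 1 0.
Proof.
rewrite (expand_det_row x 0) big_ord_recl big_ord1 /cofactor !det_mx11 !mxE.
rewrite expr0 expr1 mul1r mulN1r mulrN.
by congr (_ * x _ _ - x _ _ * x _ _); apply: val_inj.
Qed.

Lemma unit_poly_F2 (p : {poly 'F_2}) : p \is a GRing.unit -> p = 1.
Proof.
rewrite poly_unitE => /andP[/eqP szp]; rewrite unitfE => p0.
rewrite (size1_polyC (eq_leq szp)).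
by case: (F2P p`_0) p0 => ->; rewrite ?eqxx.
Qed.

Lemma det_Gamma1 (g : 'M[{poly 'F_2}]_2) : g \in unitmx -> \det g = 1.
Proof. by rewrite unitmxE; exact: unit_poly_F2. Qed.

Lemma const_unitmx (g : 'M[{poly 'F_2}]_2) :
  g \in unitmx -> (forall i j, (size (g i j)%R <= 1)%N) ->
  exists2 s : 'M['F_2]_2, s \in unitmx & g = map_mx polyC s.
Proof.
move=> gU sz; exists (map_mx (horner_eval 0) g).
  exact: map_mx_rmorph_unit.
apply/matrixP => i j; rewrite !mxE /horner_eval.
by rewrite {2}(size1_polyC (sz i j)) hornerC -size1_polyC.
Qed.

Lemma std0M x y : std_order 0 x -> std_order 0 y -> std_order 0 (x *m y).
Proof. by case: std0_order => _ _; exact. Qed.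

Lemma act_std0_const (s : 'M['F_2]_2) :
  s \in unitmx -> act (map_mx polyC s) (std_order 0) = std_order 0.
Proof.
have O_const (s' : 'M['F_2]_2) : std_order 0 (map_mx poly_KP (map_mx polyC s')).
  by apply/std0P => i j; rewrite !mxE poly_KP_C; exact: OP_tofrac.
move=> sU; have CsU := map_mx_rmorph_unit polyC sU.
apply/seteqP; split=> x.
  case=> y Oy <-; rewrite (invmx_poly_KP CsU) invmx_map_mx_rmorph //.
  exact: (std0M (std0M (O_const _) Oy) (O_const _)).
move=> Ox; apply/(actP _ _ CsU); rewrite invmx_map_mx_rmorph //.
exact: (std0M (std0M (O_const _) Ox) (O_const _)).
Qed.

Lemma stab_std0P (g : 'M[{poly 'F_2}]_2) :
  g \in unitmx -> act g (std_order 0) = std_order 0 <->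
  exists2 s : 'M['F_2]_2, s \in unitmx & g = map_mx polyC s.
Proof.
move=> gU; split=> [stab|[s sU ->]]; last exact: act_std0_const.
by apply: const_unitmx => // i j; apply: (stab_std0 _ _ gU); rewrite stab.
Qed.

(** Conjugation by diag(t, 1) multiplies the entry 01 by t and divides the entry 10 by t. It carries
    the maximality of v_0 over to v_1. *)
Lemma std1_conjset :
  exists2 d, d \in unitmx & std_order 1 = conjset d (std_order 0).
Proof.
pose d := mx22 tP 0 0 1; pose d' := mx22 piP 0 0 1.
have d'd : d' *m d = 1%:M.
  by rewrite mx22M !mulr0 !mul0r mulr1 !addr0 add0r (mulfV piP_neq0) mx22_1.
have [_ dU] := mulmx1_unit d'd.
exists d => //; apply/seteqP; split=> x.
  move=> /std1P[O00 O01 O10 O11]; apply/(conjsetP _ _ dU); apply/std0P.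
  rewrite (invmx_unique d'd) (mx22_eta x) !mx22M; apply: ord2P; apply: ord2P;
    rewrite mxE /= ?(mul0r, mulr0, mul1r, mulr1, addr0, add0r) //.
    by rewrite mulrAC (mulfV piP_neq0) mul1r.
  by rewrite mulrC.
move/(conjsetP _ _ dU)/std0P.
rewrite (invmx_unique d'd) (mx22_eta x) !mx22M => Ox; apply/std1P.
split; [move: (Ox 0 0)|move: (Ox 0 1)|move: (Ox 1 0)|move: (Ox 1 1)];
  rewrite !mxE /= ?(mul0r, mulr0, mul1r, mulr1, addr0, add0r) //.
  by rewrite mulrAC (mulfV piP_neq0) mul1r.
by rewrite mulrC.
Qed.

Lemma std1_max_order : is_max_order (std_order 1).
Proof.
have [d dU ->] := std1_conjset.
exact: max_order_conjset dU std0_max_order.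
Qed.

Lemma std1M x y : std_order 1 x -> std_order 1 y -> std_order 1 (x *m y).
Proof. by case: std1_max_order => -[_ _ mul1] _; exact: mul1. Qed.

Definition umx (b : {poly 'F_2}) := mx22 1 b 0 1.

Lemma addpp_F2 (p : {poly 'F_2}) : p + p = 0.
Proof. by apply: addrr_pchar2; rewrite pchar_poly pchar_Fp. Qed.

Lemma umxM b c : umx b *m umx c = umx (b + c).
Proof.
by rewrite mx22M !(mul0r, mulr0, mul1r, mulr1, addr0, add0r) [c + b]addrC.
Qed.

Lemma umxK b : umx b *m umx b = 1%:M.
Proof. by rewrite umxM addpp_F2 mx22_1. Qed.

Lemma umx_unit b : umx b \in unitmx.
Proof. by case: (mulmx1_unit (umxK b)). Qed.

(** For deg b <= 1 the matrix [umx b], its own inverse in characteristic 2, lies in the order v_1,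
    which is stable under conjugation by its own units. *)
Lemma act_std1_umx (b : {poly 'F_2}) :
  (size b <= 2)%N -> act (umx b) (std_order 1) = std_order 1.
Proof.
move=> szb; have bU := umx_unit b; have bV := invmx_unique (umxK b).
have std1_u : std_order 1 (map_mx poly_KP (umx b)).
  rewrite map_mx22 rmorph0 rmorph1; apply/std1P; rewrite !mxE /= mulr0.
  split; [exact: OP1 | | exact: OP0 | exact: OP1].
  by rewrite -[piP]expr1; apply/OP_poly_KP.
apply/seteqP; split=> x.
  case=> y Oy <-; rewrite (invmx_poly_KP bU) bV.
  exact: (std1M (std1M std1_u Oy) std1_u).
move=> Ox; apply/(actP _ _ bU); rewrite bV.
exact: (std1M (std1M std1_u Ox) std1_u).
Qed.

(** Adjacency is defined with [std_order (- 1)]. Exchanging the two basis vectors by [w] turns it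
    into [std_order 1] and preserves M_2(O_P). *)
Lemma tree_adj_std : tree_adj (std_order 0) (std_order 1).
Proof.
pose w : 'M[KP]_2 := mx22 0 1 1 0.
have ww : w *m w = 1%:M.
  by rewrite mx22M !(mul0r, mulr0, mul1r, addr0, add0r) mx22_1.
have [_ wU] := mulmx1_unit ww; have wV := invmx_unique ww.
have wxw x : w *m x *m w = mx22 (x 1 1) (x 1 0) (x 0 1) (x 0 0).
  by rewrite {1}(mx22_eta x) !mx22M !(mul0r, mulr0, mul1r, mulr1, addr0, add0r).
exists w; split=> //; apply/seteqP; split=> x.
- move/std0P=> Ox; apply/(conjsetP _ _ wU); rewrite wV wxw; apply/std0P.
  by apply: ord2P; apply: ord2P; rewrite mxE /=.
- move/(conjsetP _ _ wU); rewrite wV wxw => /std0P Ox; apply/std0P.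
  apply: ord2P; apply: ord2P;
    [move: (Ox 1 1)|move: (Ox 1 0)|move: (Ox 0 1)|move: (Ox 0 0)];
    by rewrite mxE.
- move/std1P=> [? ? ? ?]; apply/(conjsetP _ _ wU); rewrite wV wxw; apply/stdN1P.
  by rewrite !mxE.
move/(conjsetP _ _ wU); rewrite wV wxw => /stdN1P.
by rewrite !mxE /= => -[? ? ? ?]; apply/std1P.
Qed.

Lemma tree_adj_act g D E :
  g \in unitmx -> tree_adj D E -> tree_adj (act g D) (act g E).
Proof.
move=> /map_poly_KP_unit gU [k [kU -> ->]]; exists (map_mx poly_KP g *m k).
by rewrite unitmx_mul gU kU /act !(conjsetM _ gU kU).
Qed.

(** The only nonzero scalar of F_2 is 1, so that proportional nonzero vectors coincide. *)
Lemma F2_parallel (c0 c1 r0 r1 : 'F_2) : c0 * r1 - c1 * r0 = 0 ->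
  ~ (c0 = 0 /\ c1 = 0) -> ~ (r0 = 0 /\ r1 = 0) -> c0 = r0 /\ c1 = r1.
Proof.
by case: (F2P c0) => ->; case: (F2P c1) => ->; case: (F2P r0) => ->;
  case: (F2P r1) => -> // _ c0r0 r0c0; exfalso; by [apply: c0r0 | apply: r0c0].
Qed.

(** By [adj_bound], row 1 of a is a constant vector r and row 0 has degree at most 1, with
    t-coefficient c. In det a = 1, the coefficient of t makes c and r proportional and the constant
    one makes r nonzero, so c is 0 or r. In the first case a is constant and fixes v_0; in the
    second, adding t times row 1 to row 0 makes a constant. The third neighbor of v_1 is v_2. *)
Lemma tree_adj_std1P (a : 'M[{poly 'F_2}]_2) : a \in unitmx ->
  tree_adj (act a (std_order 0)) (std_order 1) <->
  act a (std_order 0) = std_order 0 \/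
  act a (std_order 0) = act (umx 'X) (std_order 0).
Proof.
move=> aU; have tU := umx_unit 'X; split=> [adj|[->|->]]; first last.
- rewrite -(act_std1_umx (eq_leq (size_polyX _))).
  exact: tree_adj_act tU tree_adj_std.
- exact: tree_adj_std.
have sz := adj_bound aU adj.
have def1 j : a 1 j = ((a 1 j)`_0)%:P by apply: size1_polyC; case: (sz j).
have [c0|c_neq0] := pselect (forall j, (a 0 j)`_1 = 0).
  left; apply/(stab_std0P aU); apply: (const_unitmx aU).
  apply: ord2P => j; last by case: (sz j).
  apply/leq_sizeP => -[//|[|k]] _; first exact: c0.
  by case: (sz j) => _ /leq_sizeP->.
right; have cE j : (a 0 j)`_1 = (a 1 j)`_0.
  have := congr1 (coefp 1) (det_Gamma1 aU).
  rewrite det_mx22 /= (def1 0) (def1 1) coefB !coefMC coef1 /= => det1.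
  have := congr1 (coefp 0) (det_Gamma1 aU).
  rewrite det_mx22 /= (def1 0) (def1 1) coefB !coefMC coef1 /= => det0.
  have [||e0 e1] := F2_parallel det1; last by move: j; apply: ord2P.
    by case=> c00 c01; apply: c_neq0; apply: ord2P.
  by case=> r0 r1; move: det0; rewrite r0 r1 !mulr0.
have taU : umx 'X *m a \in unitmx by rewrite unitmx_mul tU.
have -> : act a (std_order 0) = act (umx 'X) (act (umx 'X *m a) (std_order 0)).
  by rewrite -(actM _ tU taU) mulmxA umxK mul1mx.
congr (act _ _).
apply/(stab_std0P taU); apply: (const_unitmx taU); apply: ord2P => j.
  rewrite mul2E !mxE /= mul1r.
  apply/leq_sizeP => -[//|[|k]] _; rewrite coefD coefXM.
    by rewrite /= cE; apply: addrr_pchar2; rewrite pchar_Fp.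
  by case: (sz j) => /leq_sizeP-> // /leq_sizeP->; rewrite ?addr0.
by rewrite mul2E !mxE /= mul0r add0r mul1r; case: (sz j).
Qed.

(** * The quotient graph *)

Section Orbits.
Implicit Types (g h s : 'M[{poly 'F_2}]_2) (f : {poly 'F_2}).

Lemma Gamma_unit f h : Gamma f h -> h \in unitmx.
Proof. by case. Qed.

Lemma Gamma_one f : Gamma f 1%:M.
Proof. by split; [exact: unitmx1 | exists 0; rewrite scaler0 addr0]. Qed.

Lemma Gamma_mul f g h : Gamma f g -> Gamma f h -> Gamma f (g *m h).
Proof.
case=> gU [a def_g] [hU [b def_h]].
split; first by rewrite /Gamma1 /= unitmx_mul gU.
exists (b + a *m h); rewrite def_g mulmxDl mul1mx scalerDr -scalemxAl addrA.
by rewrite -def_h.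
Qed.

Lemma Gamma_inv f g : Gamma f g -> Gamma f (invmx g).
Proof.
case=> gU [a def_g]; split; first by rewrite /Gamma1 /= unitmx_inv.
have fa : f *: a = g - 1%:M by rewrite def_g addrAC subrr add0r.
exists (- (a *m invmx g)).
by rewrite scalerN scalemxAl fa mulmxBl mul1mx mulmxV // opprB addrC subrK.
Qed.

Lemma orbit_self f D : orbit f D D.
Proof. by exists 1%:M; [exact: Gamma_one | exact: act1]. Qed.

Lemma orbit_act f h D : Gamma f h -> orbit f (act h D) = orbit f D.
Proof.
move=> Gh; have hU := Gamma_unit Gh; apply/seteqP; split=> _ [g Gg <-].
  by exists (g *m h); [exact: Gamma_mul | rewrite actM ?(Gamma_unit Gg)].
exists (g *m invmx h); first exact: Gamma_mul (Gamma_inv Gh).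
by rewrite actM ?unitmx_inv ?(Gamma_unit Gg) // actK.
Qed.

Lemma orbit_eqP f D E :
  orbit f D = orbit f E <-> exists2 h, Gamma f h & E = act h D.
Proof.
split=> [eqDE|[h Gh ->]]; last by rewrite orbit_act.
by have := orbit_self f E; rewrite -eqDE => -[h Gh <-]; exists h.
Qed.

Definition congr_mx f g h := exists a, h = g + f *: a.

(** If h D = k g D with k in Gamma(f), then s = (k g)^-1 h fixes D and g s = k^-1 h is congruent to
    h. Conversely, h (g s)^-1 is congruent to 1. Orbits thus become cosets of the image of the
    stabilizer modulo f. *)
Lemma orbit_act_eqP f D g h : g \in unitmx -> h \in unitmx ->
  orbit f (act g D) = orbit f (act h D) <->
  exists s, [/\ s \in unitmx, act s D = D & congr_mx f (g *m s) h].
Proof.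
move=> gU hU; rewrite orbit_eqP; split.
  case=> k Gk eqD; have kU := Gamma_unit Gk.
  have kgU : k *m g \in unitmx by rewrite unitmx_mul kU.
  have kgVU : invmx (k *m g) \in unitmx by rewrite unitmx_inv.
  exists (invmx (k *m g) *m h); split; first by rewrite unitmx_mul kgVU.
    by rewrite (actM _ kgVU hU) eqD -(actM _ kU gU) (actK _ kgU).
  have [_ [a def_k]] := Gamma_inv Gk.
  exists (- (a *m h)).
  rewrite (invmx_mul kU gU) !mulmxA (mulmxV gU) mul1mx def_k.
  by rewrite mulmxDl mul1mx scalerN -scalemxAl addrK.
case=> s [sU stab [a def_h]].
have gsU : g *m s \in unitmx by rewrite unitmx_mul gU.
have hgsU : h *m invmx (g *m s) \in unitmx by rewrite unitmx_mul hU unitmx_inv.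
exists (h *m invmx (g *m s)).
  split=> //; exists (a *m invmx (g *m s)).
  by rewrite def_h mulmxDl (mulmxV gsU) scalemxAl.
have -> : act g D = act (g *m s) D by rewrite (actM _ gU sU) stab.
by rewrite -(actM _ hgsU gsU) (mulmxKV gsU).
Qed.

Lemma quot_typeP f n u : is_max_order (std_order n%:Z) ->
  quot_type f n u <->
  exists2 g, g \in unitmx & u = orbit f (act g (std_order n%:Z)).
Proof.
move=> maxn; split=> [[[D _ <-] [_ [h Gh <-] [g gU def_g]]]|[g gU ->]].
  by exists g; [exact: gU | rewrite -def_g (orbit_act _ Gh)].
split; last first.
  exists (act g (std_order n%:Z)); first exact: orbit_self.
  by exists g; [exact: gU |].
exists (act g (std_order n%:Z)); last by [].
exact: max_order_conjset (map_poly_KP_unit gU) maxn.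
Qed.

Lemma tree_adj_eq D E D' E' :
  D = D' -> E = E' -> tree_adj D E -> tree_adj D' E'.
Proof. by move=> -> ->. Qed.

Lemma tree_adj_act_std1P g h : g \in unitmx -> h \in unitmx ->
  tree_adj (act h (std_order 0)) (act g (std_order 1)) <->
  act h (std_order 0) = act g (std_order 0) \/
  act h (std_order 0) = act (g *m umx 'X) (std_order 0).
Proof.
move=> gU hU; have gVU := etrans (unitmx_inv g) gU; have tU := umx_unit 'X.
(* The casts give [a] the same ring instances as [g] and [h]; with others,
   unification of the vertices below would unfold the arithmetic of [KP]. *)
pose a : 'M[{poly 'F_2}]_2 := (invmx g : 'M[{poly 'F_2}]_2) *m h.
have aU : a \in unitmx by rewrite unitmx_mul gVU.
have ga : g *m a = h by exact: mulKVmx.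
have act_h : act g (act a (std_order 0)) = act h (std_order 0).
  by rewrite -ga (actM (std_order 0) gU aU).
have act_gt := actM (std_order 0) gU tU.
split=> [adj|].
  have := tree_adj_eq (esym (actM (std_order 0) gVU hU)) (actK (std_order 1) gU)
                      (tree_adj_act gVU adj).
  case/(tree_adj_std1P aU) => /(congr1 (act g)) eq_a.
    by left; exact: etrans (esym act_h) eq_a.
  by right; rewrite act_gt; refine (etrans (esym act_h) _); exact eq_a.
case=> act_eq; apply: (tree_adj_eq (esym act_eq) erefl).
  exact: tree_adj_act gU tree_adj_std.
apply: (tree_adj_eq (esym act_gt) erefl (tree_adj_act gU _)).
exact ((tree_adj_std1P tU).2 (or_intror erefl)).
Qed.

(** An adjacency in the quotient is one in the tree between k h v_0 and l g v_1 with k and l in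
    Gamma(f). The type-0 neighbors of l g v_1 are l g v_0 and l g u v_0, and l disappears on passing
    to orbits. *)
Lemma quot_adj_type1P f g u : g \in unitmx -> quot_type f 0 u ->
  quot_adj u (orbit f (act g (std_order 1))) <->
  u = orbit f (act g (std_order 0)) \/
  u = orbit f (act (g *m umx 'X) (std_order 0)).
Proof.
move=> gU u0; have tU := umx_unit 'X.
have gtU : g *m umx 'X \in unitmx by rewrite unitmx_mul gU tU.
split.
  have [h hU ->] := (quot_typeP _ _ std0_max_order).1 u0.
  case=> [_ [_ [[k Gk <-] [l Gl <-] adj]]].
  have [kU lU] := (Gamma_unit Gk, Gamma_unit Gl).
  have lgU : l *m g \in unitmx by rewrite unitmx_mul lU.
  have khU : k *m h \in unitmx by rewrite unitmx_mul kU.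
  have orb_l (x : 'M[{poly 'F_2}]_2) : x \in unitmx ->
    orbit f (act (l *m x) (std_order 0)) = orbit f (act x (std_order 0)).
    move=> xU; rewrite (actM (std_order 0) lU xU).
    exact (orbit_act (act x (std_order 0)) Gl).
  have orb_k :
    orbit f (act (k *m h) (std_order 0)) = orbit f (act h (std_order 0)).
    rewrite (actM (std_order 0) kU hU).
    exact (orbit_act (act h (std_order 0)) Gk).
  have := tree_adj_eq (esym (actM (std_order 0) kU hU))
                      (esym (actM (std_order 1) lU gU)) adj.
  case/(tree_adj_act_std1P lgU khU) => /(congr1 (orbit f)) eq_orb.
    by left; refine (etrans (esym orb_k) (etrans eq_orb (orb_l _ gU))).
  right; move: eq_orb; rewrite -mulmxA => eq_orb.
  refine (etrans (esym orb_k) (etrans eq_orb (orb_l _ gtU))).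
case=> ->.
  exists (act g (std_order 0)), (act g (std_order 1)).
  split; [exact: orbit_self | exact: orbit_self |].
  exact ((tree_adj_act_std1P gU gU).2 (or_introl erefl)).
exists (act (g *m umx 'X) (std_order 0)), (act g (std_order 1)).
split; [exact: orbit_self | exact: orbit_self |].
exact ((tree_adj_act_std1P gU gtU).2 (or_intror erefl)).
Qed.
End Orbits.

(** * From invariants of cosets to an isomorphism of multigraphs *)

Lemma inj_surj_bij (A B : Type) (F : A -> B) :
  injective F -> (forall y, exists x, F x = y) -> bijective F.
Proof.
move=> injF /choice[G FK]; exists G => // x.
by apply: injF; rewrite FK.
Qed.

Lemma eq_set2 (T : Type) (a b c d : T) : [set a; b] = [set c; d] ->
  a = c /\ b = d \/ a = d /\ b = c.
Proof.
move=> eqS; have in_cd x : [set a; b] x -> x = c \/ x = d by rewrite eqS.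
have in_ab x : [set c; d] x -> x = a \/ x = b by rewrite -eqS.
have [ac|ad] := in_cd a (or_introl erefl);
  have [bc|bd] := in_cd b (or_intror erefl).
- by left; split=> //; case: (in_ab d (or_intror erefl)) => ->; rewrite // ac.
- by left.
- by right.
- by right; split=> //; case: (in_ab c (or_introl erefl)) => ->; rewrite // ad.
Qed.

Lemma sval_inj (T : Type) (P : T -> Prop) : injective (@proj1_sig T P).
Proof.
by move=> [x Px] [y Py] /= exy; subst y; congr exist; exact: Prop_irrelevance.
Qed.

(** To be read with [good] selecting Gamma(1), [t] the right multiplication by u, [o0] and [o1] the
    orbits of g v_0 and g v_1, and [phi] an invariant of the coset. The last hypothesis makes a
    type-1 vertex depend only on its unordered ends, which excludes multiple edges; irreflexivity of
    [e] keeps the two ends apart. *)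
Lemma ograph_iso (f : {poly 'F_2}) (T : finType) (e : rel T)
    (G : Type) (good : G -> Prop) (t : G -> G)
    (o0 o1 : G -> set (set 'M[KP]_2)) (phi : G -> T) :
    irreflexive e ->
    (forall u, quot_type f 0 u <-> exists2 g, good g & u = o0 g) ->
    (forall u, quot_type f 1 u <-> exists2 g, good g & u = o1 g) ->
    (forall g u, good g -> quot_type f 0 u ->
      quot_adj u (o1 g) <-> u = o0 g \/ u = o0 (t g)) ->
    (forall g, good g -> good (t g)) ->
    (forall g h, good g -> good h -> o0 g = o0 h <-> phi g = phi h) ->
    (forall x, exists2 g, good g & phi g = x) ->
    (forall g, good g -> e (phi g) (phi (t g))) ->
    (forall x y, e x y -> exists g, [/\ good g, phi g = x & phi (t g) = y]) ->
    (forall g h, good g -> good h ->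
      phi g = phi h /\ phi (t g) = phi (t h) \/
      phi g = phi (t h) /\ phi (t g) = phi h -> o1 g = o1 h) ->
  mg_iso (ograph f) (simple_graph e).
Proof.
move=> e_irr type0P type1P adjP t_good phi_o0 phi_surj phi_adj adj_phi phi_o1.
have /choice[rep repP] :
    forall u : overtex f, exists g, good g /\ sval u = o0 g.
  by move=> -[u u0]; have [g gG ug] := (type0P u).1 u0; exists g.
pose Phi u := phi (rep u).
have PhiE u g : good g -> sval u = o0 g -> Phi u = phi g.
  move=> gG ug; have [rG ur] := repP u.
  by apply/phi_o0 => //; rewrite -ur.
have Phi_inj : injective Phi.
  move=> u v /phi_o0 uv; have [[ru eu] [rv ev]] := (repP u, repP v).
  by apply: sval_inj; rewrite eu ev; exact: uv.
have mk g : good g -> exists u : overtex f, sval u = o0 g.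
  by move=> gG; have u0 := (type0P (o0 g)).2 (ex_intro2 _ _ g gG erefl);
    exists (exist _ (o0 g) u0).
have edgeP (p : oedge f) : exists g (u v : overtex f),
    [/\ good g, sval u = o0 g, sval v = o0 (t g), (sval p).1 = [set u; v] &
        (sval p).2 = o1 g].
  case: p => -[A x] /= [/type1P[g gG ->] [u [w [-> adj_u adj_w uw]]]].
  have tgG := t_good g gG.
  have [[u0 u0E] [u1 u1E]] := (mk g gG, mk _ tgG).
  have u01 : u0 <> u1.
    move=> eq_u; have := phi_adj g gG.
    by rewrite -(PhiE _ _ gG u0E) -(PhiE _ _ tgG u1E) eq_u e_irr.
  have adj_cases z : quot_adj (sval z) (o1 g) -> z = u0 \/ z = u1.
    move=> /(adjP _ _ gG (svalP z)) zE.
    by case: zE => zE; [left | right]; apply: sval_inj; rewrite zE.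
  have adj0 : quot_adj (sval u0) (o1 g).
    by apply/(adjP _ _ gG (svalP u0)); left.
  have adj1 : quot_adj (sval u1) (o1 g).
    by apply/(adjP _ _ gG (svalP u1)); right.
  exists g, u0, u1; split=> //.
  (* A loop at u would force both [u0] and [u1] to be u. *)
  case: uw => [uw|all_u]; last first.
    by case: u01; rewrite (all_u _ adj0) (all_u _ adj1).
  have [uE|uE] := adj_cases _ adj_u; have [wE|wE] := adj_cases _ adj_w;
    rewrite uE wE // in uw *.
  exact: setUC.
have psiP (p : oedge f) : exists x y, e x y /\ Phi @` (sval p).1 = [set x; y].
  have [g [u [v [gG uE vE -> _]]]] := edgeP p.
  exists (Phi u), (Phi v); rewrite image_setU !image_set1; split=> //.
  by rewrite (PhiE _ _ gG uE) (PhiE _ _ (t_good _ gG) vE); exact: phi_adj.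
have psi_inj (p q : oedge f) : Phi @` (sval p).1 = Phi @` (sval q).1 -> p = q.
  have [g [u [v [gG uE vE p1 p2]]]] := edgeP p.
  have [h [u' [v' [hG uE' vE' q1 q2]]]] := edgeP q.
  rewrite p1 q1 !image_setU !image_set1 => eq_img.
  have eqS := eq_set2 eq_img.
  apply: sval_inj; rewrite [LHS]surjective_pairing [RHS]surjective_pairing.
  rewrite p1 q1 p2 q2; congr (_, _).
    by case: eqS => -[/Phi_inj eu /Phi_inj ev]; rewrite eu ev //; exact: setUC.
  apply: (phi_o1 _ _ gG hG); move: eqS.
  by rewrite (PhiE _ _ gG uE) (PhiE _ _ (t_good _ gG) vE)
             (PhiE _ _ hG uE') (PhiE _ _ (t_good _ hG) vE').
pose psi (p : oedge f) : mg_edge (simple_graph e) := exist _ _ (psiP p).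
exists Phi, psi; split=> //.
  apply: inj_surj_bij => // x; have [g gG <-] := phi_surj x.
  by have [u uE] := mk g gG; exists u; exact: PhiE.
apply: inj_surj_bij => [p q /(congr1 sval)/psi_inj //|[A [x [y [exy defA]]]]].
have [g [gG gx gy]] := adj_phi x y exy; have tgG := t_good g gG.
have [[u uE] [v vE]] := (mk g gG, mk _ tgG).
have edge_uv : quot_type f 1 (o1 g) /\ exists a b : overtex f,
   [/\ [set u; v] = [set a; b], quot_adj (sval a) (o1 g),
       quot_adj (sval b) (o1 g) &
       a <> b \/ forall z : overtex f, quot_adj (sval z) (o1 g) -> z = a].
  split; first by apply/type1P; exists g.
  exists u, v; split=> //.
  - by apply/(adjP _ _ gG (svalP u)); left.
  - by apply/(adjP _ _ gG (svalP v)); right.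
  left=> eq_uv; move: exy.
  by rewrite -gx -gy -(PhiE _ _ gG uE) -(PhiE _ _ tgG vE) eq_uv e_irr.
exists (exist _ ([set u; v], o1 g) edge_uv); apply: sval_inj => /=.
by rewrite image_setU !image_set1 (PhiE _ _ gG uE) (PhiE _ _ tgG vE) gx gy.
Qed.

(** * Reduction modulo f *)

(* The pair [(a, b)] stands for the class of [a + b t] modulo [f], where
   [f = t^2 + f1 t + f0], and [rmx] lists the entries of a 2 x 2 matrix. *)
Definition res : Type := (bool * bool)%type.
Definition rmx : Type := (res * res * res * res)%type.

Definition res_lift (r : res) : {poly 'F_2} := (r.1%:R)%:P + (r.2%:R)%:P * 'X.

Definition red_poly (f p : {poly 'F_2}) : res :=
  ((p %% f)`_0 != 0, (p %% f)`_1 != 0).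

Definition resD (a b : res) : res := (a.1 (+) b.1, a.2 (+) b.2).

(** The product reduced by t^2 = f1 t + f0, signs being immaterial in characteristic 2. *)
Definition resM (f0 f1 : bool) (a b : res) : res :=
  ((a.1 && b.1) (+) [&& a.2, b.2 & f0],
   (a.1 && b.2) (+) (a.2 && b.1) (+) [&& a.2, b.2 & f1]).

Lemma natr_F2_andb (a b : bool) : (a && b)%:R = a%:R * b%:R :> 'F_2.
Proof. by case: a; case: b; rewrite ?mulr0 ?mul0r ?mulr1. Qed.

Lemma natr_F2_addb (a b : bool) : (a (+) b)%:R = a%:R + b%:R :> 'F_2.
Proof. by case: a; case: b; apply: val_inj. Qed.

(** Besides the sum, exclusive or is also the difference. With this form, the reduction t^2 = f - f1
    t - f0 in [res_liftM] is an identity over any commutative ring, within reach of [ring]. *)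
Lemma natr_F2_subb (a b : bool) : (a (+) b)%:R = a%:R - b%:R :> 'F_2.
Proof. by case: a; case: b; apply: val_inj. Qed.

Lemma natr_F2_neq0 (a : 'F_2) : (a != 0)%:R = a.
Proof. by case: (F2P a) => ->. Qed.

Lemma size_res_lift r : (size (res_lift r) <= 2)%N.
Proof.
apply: leq_trans (size_polyD _ _) _; rewrite geq_max size_polyC.
apply/andP; split; first by case: (r.1%:R != 0).
by rewrite mul_polyC (leq_trans (size_scale_leq _ _)) ?size_polyX.
Qed.

Section Reduction.
Variables (f : {poly 'F_2}) (deg_f : size f = 3%N).
Let f0 := f`_0 != 0.
Let f1 := f`_1 != 0.

Lemma quadratic_polyE : f = 'X^2 + (f1%:R)%:P * 'X + (f0%:R)%:P.
Proof.
have f2 : f`_2 = 1.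
  have : lead_coef f != 0 by rewrite lead_coef_eq0 -size_poly_eq0 deg_f.
  by rewrite lead_coefE deg_f; case: (F2P f`_2) => ->; rewrite ?eqxx.
apply/polyP => i; rewrite !coefD coefXn coefMX !coefC /f0 /f1 !natr_F2_neq0.
case: i => [|[|[|i]]] //=; rewrite ?addr0 ?add0r //.
by rewrite nth_default ?deg_f.
Qed.

Lemma ltn_res_lift r : (size (res_lift r) < size f)%N.
Proof. by rewrite deg_f ltnS size_res_lift. Qed.

Lemma red_polyE p : p %% f = res_lift (red_poly f p).
Proof.
have f_neq0 : f != 0 by rewrite -size_poly_eq0 deg_f.
have := ltn_modpN0 p f_neq0; rewrite deg_f => szp.
apply/polyP => i; rewrite coefD coefMX !coefC /= !natr_F2_neq0.
case: i => [|[|i]] //=; rewrite ?addr0 ?add0r //.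
by rewrite nth_default // -ltnS (leq_trans szp).
Qed.

Lemma res_lift_inj : injective res_lift.
Proof.
move=> [a0 a1] [b0 b1] eq_ab.
have := congr1 (coefp 0) eq_ab; have := congr1 (coefp 1) eq_ab.
rewrite /= !coefD !coefMX !coefC /= !add0r !addr0.
by clear; case: a0; case: a1; case: b0; case: b1.
Qed.

Lemma red_polyP p r q : p = q * f + res_lift r -> red_poly f p = r.
Proof.
move=> ->; apply: res_lift_inj; rewrite -red_polyE modp_addl_mul_small //.
exact: ltn_res_lift.
Qed.

Lemma red_poly_lift r : red_poly f (res_lift r) = r.
Proof. by apply: (@red_polyP _ _ 0); rewrite mul0r add0r. Qed.

Lemma red_poly_div p : p = p %/ f * f + res_lift (red_poly f p).
Proof. by rewrite -red_polyE -divp_eq. Qed.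

Lemma res_liftD a b : res_lift (resD a b) = res_lift a + res_lift b.
Proof.
by rewrite /res_lift /= !natr_F2_addb !polyCD; ring.
Qed.

Lemma res_liftM a b :
  res_lift a * res_lift b = (a.2 && b.2)%:R%:P * f + res_lift (resM f0 f1 a b).
Proof.
rewrite [in RHS]quadratic_polyE /res_lift /=.
rewrite (natr_F2_subb (_ (+) _)) (natr_F2_addb (a.1 && b.2)) natr_F2_subb.
by rewrite !natr_F2_andb !(polyCB, polyCD, polyCM); ring.
Qed.

Lemma red_polyD p q : red_poly f (p + q) = resD (red_poly f p) (red_poly f q).
Proof.
apply: (@red_polyP _ _ (p %/ f + q %/ f)).
by rewrite res_liftD {1}(red_poly_div p) {1}(red_poly_div q); ring.
Qed.

Lemma red_polyM p q :
  red_poly f (p * q) = resM f0 f1 (red_poly f p) (red_poly f q).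
Proof.
set a := red_poly f p; set b := red_poly f q.
pose u := p %/ f; pose v := q %/ f.
(* The quotient comes from expanding (u f + a)(v f + b); its last term is the quotient of a b by f,
   given by [res_liftM]. *)
apply: (@red_polyP _ _ (u * v * f + u * res_lift b + v * res_lift a +
                        (a.2 && b.2)%:R%:P)).
rewrite [in RHS]mulrDl -addrA -res_liftM (red_poly_div p) (red_poly_div q).
by rewrite -/a -/b -/u -/v; ring.
Qed.

Lemma red_poly_eq p q : red_poly f p = red_poly f q <-> exists a, q = p + f * a.
Proof.
split=> [eq_pq|[a ->]].
  exists (q %/ f - p %/ f).
  by rewrite {1}(red_poly_div q) {1}(red_poly_div p) eq_pq; ring.
apply/esym/(@red_polyP _ _ (p %/ f + a)).
by rewrite {1}(red_poly_div p); ring.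
Qed.

Lemma red_polyC (c : 'F_2) : red_poly f c%:P = (c != 0, false).
Proof.
apply: (@red_polyP _ _ 0).
by rewrite mul0r add0r /res_lift /= natr_F2_neq0 mul0r addr0.
Qed.

Definition red_mx (g : 'M[{poly 'F_2}]_2) : rmx :=
  (red_poly f (g 0 0), red_poly f (g 0 1),
   red_poly f (g 1 0), red_poly f (g 1 1)).

Lemma red_mx_eq g h : red_mx g = red_mx h <-> congr_mx f g h.
Proof.
split=> [eq_gh|[a ->]].
  have [a ga] := (red_poly_eq _ _).1 (congr1 (fun x : rmx => x.1.1.1) eq_gh).
  have [b gb] := (red_poly_eq _ _).1 (congr1 (fun x : rmx => x.1.1.2) eq_gh).
  have [c gc] := (red_poly_eq _ _).1 (congr1 (fun x : rmx => x.1.2) eq_gh).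
  have [d gd] := (red_poly_eq _ _).1 (congr1 (fun x : rmx => x.2) eq_gh).
  exists (mx22 a b c d); apply/matrixP.
  by apply: ord2P; apply: ord2P; rewrite !mxE.
by rewrite /red_mx !mxE; congr (_, _, _, _); apply/red_poly_eq; eexists.
Qed.
End Reduction.

Definition rmxM (f0 f1 : bool) (x y : rmx) : rmx :=
  let: (a, b, c, d) := x in let: (a', b', c', d') := y in
  let M := resM f0 f1 in
  (resD (M a a') (M b c'), resD (M a b') (M b d'),
   resD (M c a') (M d c'), resD (M c b') (M d d')).

Definition res_det (f0 f1 : bool) (x : rmx) : res :=
  let: (a, b, c, d) := x in resD (resM f0 f1 a d) (resM f0 f1 b c).

Definition all_res : seq res :=
  [:: (false, false); (true, false); (false, true); (true, true)].

Definition all_rmx : seq rmx :=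
  let p := allpairs pair all_res all_res in
  allpairs pair (allpairs pair p all_res) all_res.

Definition rmx_SL (f0 f1 : bool) : seq rmx :=
  [seq x <- all_rmx | res_det f0 f1 x == (true, false)].

Definition rmx_const (x : rmx) : bool :=
  let: (a, b, c, d) := x in [&& ~~ a.2, ~~ b.2, ~~ c.2 & ~~ d.2].

Definition rmx_u (b : res) : rmx :=
  ((true, false), b, (false, false), (true, false)).

Definition rmx_l (b : res) : rmx :=
  ((true, false), (false, false), b, (true, false)).

Definition rmx_word (f0 f1 : bool) (w : rmx) : rmx :=
  let: (a, b, c, d) := w in
  rmxM f0 f1 (rmxM f0 f1 (rmx_u a) (rmx_l b)) (rmxM f0 f1 (rmx_u c) (rmx_l d)).

(* SL_2 of a semilocal ring is generated by elementary matrices; four factors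
   of alternating types are enough. *)
Lemma rmx_SL_word f0 f1 x :
  x \in rmx_SL f0 f1 -> exists w, rmx_word f0 f1 w = x.
Proof.
have /allP words : all (fun x => has (fun w => rmx_word f0 f1 w == x) all_rmx)
                       (rmx_SL f0 f1).
  by case: f0; case: f1; vm_compute.
by move=> /words/hasP[w _ /eqP]; exists w.
Qed.

Lemma mem_all_res a : a \in all_res.
Proof. by case: a => [[] []]. Qed.

Lemma mem_all_rmx x : x \in all_rmx.
Proof.
by case: x => [[[a b] c] d]; do 3?[apply: allpairs_f]; exact: mem_all_res.
Qed.

Definition umxT (b : {poly 'F_2}) : 'M[{poly 'F_2}]_2 := mx22 1 0 b 1.

Lemma umxT_unit b : umxT b \in unitmx.
Proof. by rewrite unitmxE det_mx22 !mxE /= mul1r mul0r subr0 unitr1. Qed.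

Section ReductionSL.
Variables (f : {poly 'F_2}) (deg_f : size f = 3%N).
Let f0 := f`_0 != 0.
Let f1 := f`_1 != 0.

Lemma red_mxM (g h : 'M[{poly 'F_2}]_2) :
  red_mx f (g *m h) = rmxM f0 f1 (red_mx f g) (red_mx f h).
Proof. by rewrite /red_mx !mul2E !(red_polyD deg_f) !(red_polyM deg_f). Qed.

Lemma red_poly0 : red_poly f 0 = (false, false).
Proof.
by rewrite -(red_poly_lift deg_f (false, false)) /res_lift mul0r addr0.
Qed.

Lemma red_poly1 : red_poly f 1 = (true, false).
Proof.
by rewrite -(red_poly_lift deg_f (true, false)) /res_lift mul0r addr0.
Qed.

Lemma red_mx_umx b : red_mx f (umx (res_lift b)) = rmx_u b.
Proof.
by rewrite /red_mx !mxE /= (red_poly_lift deg_f) red_poly0 red_poly1.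
Qed.

Lemma red_mx_umxT b : red_mx f (umxT (res_lift b)) = rmx_l b.
Proof.
by rewrite /red_mx !mxE /= (red_poly_lift deg_f) red_poly0 red_poly1.
Qed.

Lemma red_mx_SL g : g \in unitmx -> red_mx f g \in rmx_SL f0 f1.
Proof.
move=> gU; rewrite mem_filter mem_all_rmx andbT /=.
have := congr1 (red_poly f) (det_Gamma1 gU).
rewrite det_mx22 -[- _]mulNr -mulN1r.
rewrite -!(red_polyM deg_f) -(red_polyD deg_f) red_poly1 => <-.
by rewrite (oppr_pchar2 (_ : 2 \in [pchar _])) ?pchar_poly ?pchar_Fp // mul1r.
Qed.

(** Elementary matrices lift to elementary matrices over F_2[t], which are still invertible; hence
    so do their products. *)
Lemma red_mx_surj x : x \in rmx_SL f0 f1 ->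
  exists2 g : 'M[{poly 'F_2}]_2, g \in unitmx & red_mx f g = x.
Proof.
case/rmx_SL_word => -[[[a b] c] d] <-.
pose u r := umx (res_lift r); pose l r := umxT (res_lift r).
exists ((u a *m l b) *m (u c *m l d)).
  by rewrite !unitmx_mul !umx_unit !umxT_unit.
by rewrite !red_mxM !red_mx_umx !red_mx_umxT.
Qed.

Lemma red_mx_const_unit (s : 'M['F_2]_2) :
  s \in unitmx ->
  red_mx f (map_mx polyC s) \in [seq x <- rmx_SL f0 f1 | rmx_const x].
Proof.
move=> sU; rewrite mem_filter red_mx_SL ?andbT; last exact: map_mx_rmorph_unit.
by rewrite /red_mx !mxE !(red_polyC deg_f).
Qed.

Lemma const_lift x : x \in rmx_SL f0 f1 -> rmx_const x ->
  exists2 s : 'M['F_2]_2, s \in unitmx & red_mx f (map_mx polyC s) = x.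
Proof.
rewrite mem_filter mem_all_rmx andbT.
case: x => [[[[a a'] [b b']] [c c']] [d d']] /eqP det_x /and4P[/= a0 b0 c0 d0].
exists (mx22 a%:R b%:R c%:R d%:R).
  move: det_x a0 b0 c0 d0; rewrite unitmxE det_mx22 !mxE /=.
  by case: a; case: b; case: c; case: d; case: a'; case: b'; case: c'; case: d'.
rewrite /red_mx !mxE /= !(red_polyC deg_f); move: a0 b0 c0 d0; clear.
by case: a' => //; case: b' => //; case: c' => //; case: d' => //;
  case: a; case: b; case: c; case: d.
Qed.

Lemma orbit0_eqP (g h : 'M[{poly 'F_2}]_2) : g \in unitmx -> h \in unitmx ->
  orbit f (act g (std_order 0)) = orbit f (act h (std_order 0)) <->
  has (fun s => red_mx f h == rmxM f0 f1 (red_mx f g) s)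
      [seq x <- rmx_SL f0 f1 | rmx_const x].
Proof.
move=> gU hU; split.
  case/(orbit_act_eqP _ _ gU hU) => s [sU stab /(red_mx_eq deg_f) <-].
  have [s0 s0U def_s] := (stab_std0P sU).1 stab.
  apply/hasP; exists (red_mx f s); last by rewrite red_mxM.
  by rewrite def_s; exact: red_mx_const_unit.
case/hasP => x; rewrite mem_filter => /andP[xc xSL] /eqP red_h.
have [s sU sx] := const_lift xSL xc.
apply/(orbit_act_eqP _ _ gU hU); exists (map_mx polyC s).
split; [exact: map_mx_rmorph_unit | exact: act_std0_const |].
by apply/(red_mx_eq deg_f); rewrite red_mxM sx.
Qed.

(** As deg f = 2, every class b has a lift of degree at most 1, whose unitriangular matrix fixes
    v_1. *)
Lemma orbit1_eq (g h : 'M[{poly 'F_2}]_2) : g \in unitmx -> h \in unitmx ->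
  has (fun b => red_mx f h == rmxM f0 f1 (red_mx f g) (rmx_u b)) all_res ->
  orbit f (act g (std_order 1)) = orbit f (act h (std_order 1)).
Proof.
move=> gU hU /hasP[b _ /eqP red_h]; apply/(orbit_act_eqP _ _ gU hU).
exists (umx (res_lift b)); split; first exact: umx_unit.
  by apply: act_std1_umx; exact: size_res_lift.
by apply/(red_mx_eq deg_f); rewrite red_mxM red_mx_umx.
Qed.
End ReductionSL.

(** * The three finite graphs *)

(** The hypotheses of [ograph_iso] on the invariant, read in SL_2(F_2[t]/f) and made boolean so that
    [vm_compute] decides them. [SLc] is SL_2(F_2). *)
Definition table_ok (C : eqType) (f0 f1 : bool) (codes : seq C) (adj : rel C)
    (psi : rmx -> C) : bool :=
  let SL := rmx_SL f0 f1 in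
  let t x := rmxM f0 f1 x (rmx_u (false, true)) in
  let SLc := [seq x <- SL | rmx_const x] in
  [&& all (fun x => (psi x \in codes) && adj (psi x) (psi (t x))) SL,
      all (fun c => has (fun x => psi x == c) SL) codes,
      all (fun c => all (fun d => adj c d ==>
        has (fun x => (psi x == c) && (psi (t x) == d)) SL) codes) codes &
      all (fun x => all (fun y =>
        (has (fun s => y == rmxM f0 f1 x s) SLc == (psi x == psi y)) &&
        ((psi x == psi y) && (psi (t x) == psi (t y)) ||
         (psi x == psi (t y)) && (psi (t x) == psi y) ==>
         has (fun b => y == rmxM f0 f1 x (rmx_u b)) all_res)) SL) SL].

(** The invariant takes its values in codes built from booleans and numbers, on which the table is
    evaluated; [dec] translates these into vertices of [T], which may be sets or finite
    functions. *)
Lemma ograph_iso_table (f : {poly 'F_2}) (T : finType) (e : rel T)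
    (C : eqType) (codes : seq C) (adj : rel C) (psi : rmx -> C) (dec : C -> T) :
    size f = 3%N -> irreflexive e ->
    {in codes &, injective dec} ->
    (forall x, exists2 c, c \in codes & dec c = x) ->
    {in codes &, forall c d, e (dec c) (dec d) = adj c d} ->
    table_ok (f`_0 != 0) (f`_1 != 0) codes adj psi ->
  mg_iso (ograph f) (simple_graph e).
Proof.
move=> deg_f e_irr dec_inj dec_surj decE.
set f0 := f`_0 != 0; set f1 := f`_1 != 0.
rewrite /table_ok; set SL := rmx_SL f0 f1.
case/and4P=> /allP psiP /allP psi_surj /allP adj_psi /allP psi_eq.
have red_SL (g : 'M[{poly 'F_2}]_2) : g \in unitmx -> red_mx f g \in SL.
  exact: red_mx_SL.
have red_t (g : 'M[{poly 'F_2}]_2) : red_mx f (g *m umx 'X) =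
    rmxM f0 f1 (red_mx f g) (rmx_u (false, true)).
  by rewrite (red_mxM deg_f) -(red_mx_umx deg_f) /res_lift /= add0r mul1r.
have t_unit (g : 'M[{poly 'F_2}]_2) : g \in unitmx -> g *m umx 'X \in unitmx.
  by move=> gU; rewrite unitmx_mul gU umx_unit.
pose phi g := dec (psi (red_mx f g)).
have codeP (g : 'M[{poly 'F_2}]_2) : g \in unitmx -> psi (red_mx f g) \in codes.
  by move=> /red_SL/psiP/andP[].
have phi_eq (g h : 'M[{poly 'F_2}]_2) : g \in unitmx -> h \in unitmx ->
    phi g = phi h -> psi (red_mx f g) = psi (red_mx f h).
  by move=> gU hU; apply: dec_inj; exact: codeP.
refine (@ograph_iso f T e _ (fun g : 'M[{poly 'F_2}]_2 => g \in unitmx)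
  (fun g => g *m umx 'X) (fun g => orbit f (act g (std_order 0)))
  (fun g => orbit f (act g (std_order 1))) phi e_irr _ _ _ t_unit _ _ _ _ _).
- by move=> u; exact: quot_typeP _ _ std0_max_order.
- by move=> u; exact: quot_typeP _ _ std1_max_order.
- by move=> g u; exact: quot_adj_type1P.
- move=> g h gU hU.
  have /andP[/eqP psi_gh _] := allP (psi_eq _ (red_SL g gU)) _ (red_SL h hU).
  have orbP := orbit0_eqP deg_f gU hU; rewrite psi_gh in orbP.
  split=> [/orbP/eqP|/(phi_eq _ _ gU hU)/eqP/orbP //].
  by rewrite /phi => ->.
- move=> x; have [c cc <-] := dec_surj x.
  have /hasP[m mSL /eqP <-] := psi_surj c cc.
  by have [g gU <-] := red_mx_surj deg_f mSL; exists g.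
- move=> g gU; rewrite /phi decE ?codeP ?t_unit // red_t.
  by case/andP: (psiP _ (red_SL g gU)).
- move=> x y; have [c cc <-] := dec_surj x; have [d cd <-] := dec_surj y.
  rewrite decE // => adj_cd.
  have := implyP (allP (adj_psi c cc) d cd) adj_cd.
  case/hasP => m mSL /andP[/eqP <- /eqP <-].
  have [g gU <-] := red_mx_surj deg_f mSL.
  by exists g; split=> //; rewrite /phi red_t.
move=> g h gU hU eq_phi; apply: (orbit1_eq deg_f gU hU).
have /andP[_ /implyP->] // := allP (psi_eq _ (red_SL g gU)) _ (red_SL h hU).
rewrite -!red_t; apply/orP; case: eq_phi => -[eq1 eq2]; [left | right];
  by apply/andP; split; apply/eqP; apply: phi_eq => //; exact: t_unit.
Qed.

(* When f = t(t+1), evaluation at 0 and 1 identifies SL_2(F_2[t]/f) with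
   S_3 x S_3 and SL_2(F_2) with the diagonal, so that a coset is given by the
   matrix g(0) g(1)^-1 of SL_2(F_2), whose entries are p, q, r and s; the two
   sides of K_{3,3} are the two values of its sign. *)
Definition code_K33 (x : rmx) : bool * nat :=
  let: (a, b, c, d) := x in
  let ev0 (r : res) := r.1 in let ev1 (r : res) := r.1 (+) r.2 in
  let p := (ev0 a && ev1 d) (+) (ev0 b && ev1 c) in
  let q := (ev0 a && ev1 b) (+) (ev0 b && ev1 a) in
  let r := (ev0 c && ev1 d) (+) (ev0 d && ev1 c) in
  let s := (ev0 c && ev1 b) (+) (ev0 d && ev1 a) in
  if p == s then
    if q || r then (true, if ~~ p then 0%N else if q then 1%N else 2)
    else (false, 0%N)
  else (false, if p then 2 else 1%N).

Definition codes_K33 : seq (bool * nat) :=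
  allpairs pair [:: false; true] (iota 0 3).

(** As u(0) = 1 and u(1) is a transposition, passing from g to g u multiplies g(0) g(1)^-1 on the
    right by the conjugate of u(1) by g(1). The sign changes, and all three transpositions occur
    when g runs through its coset. *)
Lemma table_K33 :
  table_ok false true codes_K33 (fun x y => x.1 != y.1) code_K33.
Proof. by vm_compute. Qed.

(* When f = (t + f0)^2, every g in SL_2(F_2[t]/f) is (1 + (t + f0) A) g(f0) with
   A of trace 0, and the coset of g is given by A; the code lists the
   coordinates of A in the basis formed by the three nonzero nilpotents. *)
Definition code_cube (f0 : bool) (x : rmx) : bool * bool * bool :=
  let: (a, b, c, d) := x in
  let ev (r : res) := r.1 (+) (r.2 && f0) in
  let p := (a.2 && ev d) (+) (b.2 && ev c) in
  let q := (a.2 && ev b) (+) (b.2 && ev a) in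
  let r := (c.2 && ev d) (+) (d.2 && ev c) in
  (p, p (+) q, p (+) r).

Definition codes_cube : seq (bool * bool * bool) :=
  let B := [:: false; true] in allpairs pair (allpairs pair B B) B.

Definition adj_cube : rel (bool * bool * bool) := fun x y =>
  ((x.1.1 != y.1.1) + (x.1.2 != y.1.2) + (x.2 != y.2) == 1)%N.

(** Since u = (1 + (t + f0) E_01) u(f0), passing from g to g u adds to A the conjugate of E_01 by
    g(f0), which is one of the three nonzero nilpotents: exactly one coordinate changes. *)
Lemma table_cube f0 : table_ok f0 false codes_cube adj_cube (code_cube f0).
Proof. by case: f0; vm_compute. Qed.

(* The point (x : y) of the projective line over F_4; as y^3 = 1 for y != 0,
   x / y = x y^2. *)
Definition code_P1 (x y : res) : nat :=
  if y == (false, false) then 4 else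
  index (resM true true x (resM true true y y)) all_res.

(* When F_2[t]/f = F_4, SL_2(F_2) is the stabilizer of the pair of the points of
   P^1(F_4) that are not in P^1(F_2), so that the cosets are the pairs of points
   of P^1(F_4). *)
Definition code_petersen (x : rmx) : nat * nat :=
  let: (a, b, c, d) := x in
  let M := resM true true in
  let pt w := code_P1 (resD (M a w) b) (resD (M c w) d) in
  let i := pt (false, true) in let j := pt (true, true) in
  (minn i j, maxn i j).

Definition codes_petersen : seq (nat * nat) :=
  [seq x <- allpairs pair (iota 0 5) (iota 0 5) | (x.1 < x.2)%N].

Definition adj_petersen : rel (nat * nat) := fun x y =>
  [&& x.1 != y.1, x.1 != y.2, x.2 != y.1 & x.2 != y.2].

(** With w the class of t, the translation u sends the pair {w, w + 1} to {0, 1}, disjoint from it;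
    hence g and g u give disjoint pairs. As SL_2(F_2) permutes the pairs of points of P^1(F_2)
    transitively, all disjoint pairs occur. *)
Lemma table_petersen :
  table_ok true true codes_petersen adj_petersen code_petersen.
Proof. by vm_compute. Qed.

(** * Decoding into the three graphs *)

Lemma eq_inord n i k : (i <= n)%N -> (k <= n)%N ->
  ((inord i : 'I_n.+1) == inord k) = (i == k).
Proof. by move=> le_i le_k; rewrite -val_eqE /= !inordK. Qed.

Lemma ograph_K33 (f : {poly 'F_2}) : size f = 3%N -> f`_0 = 0 -> f`_1 = 1 ->
  mg_iso (ograph f) K33.
Proof.
move=> deg_f f0 f1; pose dec (c : bool * nat) : bool * 'I_3 := (c.1, inord c.2).
have codeP c : (c \in codes_K33) = (c.2 < 3)%N.
  by case: c => -[] [|[|[|n]]].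
apply: (ograph_iso_table (dec := dec) (codes := codes_K33)
          (adj := fun x y => x.1 != y.1) (psi := code_K33)) => //.
- by move=> x; rewrite /K33_rel eqxx.
- move=> [a i] [b j]; rewrite !codeP /= => lti ltj [-> /eqP].
  by rewrite eq_inord // => /eqP->.
- move=> [a i]; exists (a, val i); first by rewrite codeP /=.
  by rewrite /dec inord_val.
by rewrite f0 f1; exact: table_K33.
Qed.

Lemma ograph_cube (f : {poly 'F_2}) : size f = 3%N -> f`_1 = 0 ->
  mg_iso (ograph f) cube.
Proof.
move=> deg_f f1.
pose dec (c : bool * bool * bool) : {ffun 'I_3 -> bool} :=
  [ffun i : 'I_3 => nth false [:: c.1.1; c.1.2; c.2] i].
have codeP c : c \in codes_cube by case: c => -[[] []] [].
apply: (ograph_iso_table (dec := dec) (codes := codes_cube)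
          (adj := adj_cube) (psi := code_cube (f`_0 != 0))) => //.
- move=> x; rewrite /cube_rel (eq_card (B := pred0)) ?card0 // => i.
  by rewrite !inE eqxx.
- move=> [[a b] c] [[a' b'] c'] _ _ /ffunP eq_dec.
  have := eq_dec (inord 0); have := eq_dec (inord 1); have := eq_dec (inord 2).
  by rewrite !ffunE !inordK //= => -> -> ->.
- move=> x; exists (x (inord 0), x (inord 1), x (inord 2)) => //.
  apply/ffunP => -[[|[|[|i]]] lti] //; rewrite ffunE /=;
    by congr (x _); apply: val_inj; rewrite /= inordK.
- move=> c d _ _; rewrite /cube_rel /adj_cube -sum1_card big_mkcond /=.
  by rewrite !big_ord_recl big_ord0 !inE !ffunE /= addn0 !addnA;
    do 3!case: eqP.
by rewrite f1; exact: table_cube.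
Qed.

Lemma card_pair5 : #|[set ord0; (ord_max : 'I_5)]%SET| == 2%N.
Proof. by rewrite cards2. Qed.

(** The value that [insubd] takes when two numbers do not give two distinct points; [decK] shows
    that codes decode to their own pair. *)
Definition pair5_default : {A : {set 'I_5} | #|A| == 2%N} :=
  exist (fun A : {set 'I_5} => #|A| == 2%N) _ card_pair5.

Lemma ograph_petersen (f : {poly 'F_2}) :
  size f = 3%N -> f`_0 = 1 -> f`_1 = 1 -> mg_iso (ograph f) petersen.
Proof.
move=> deg_f f0 f1.
pose set_of (c : nat * nat) : {set 'I_5} := [set inord c.1; inord c.2]%SET.
pose dec c : {A : {set 'I_5} | #|A| == 2%N} :=
  insubd pair5_default (set_of c).
have codeP c : (c \in codes_petersen) = (c.1 < c.2 < 5)%N.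
  case: c => i j; rewrite mem_filter; apply/andP/andP=> -[ltij].
    case/allpairsP=> -[k l] [_ ltl [_ eq_j]]; split=> //.
    rewrite [X in (X < _)%N]eq_j; by move: ltl; rewrite mem_iota.
  move=> ltj; split=> //; apply: (allpairs_f pair); rewrite mem_iota //=.
  exact: ltn_trans ltj.
have decK c : c \in codes_petersen -> val (dec c) = set_of c.
  rewrite codeP => /andP[ltij ltj]; apply: insubdK.
  rewrite unfold_in cards2 eq_inord ?(ltn_eqF ltij) //.
  by rewrite -ltnS (ltn_trans ltij).
have decE : {in codes_petersen &, forall c d,
    petersen_rel (dec c) (dec d) = adj_petersen c d}.
  move=> c d Cc Cd; rewrite /petersen_rel !decK //.
  move: Cc Cd; rewrite !codeP => /andP[ltij ltj] /andP[ltkl ltl].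
  have [lti ltk] := (ltn_trans ltij ltj, ltn_trans ltkl ltl).
  by rewrite finset.disjoints_subset finset.subUset !finset.sub1set !inE
    !negb_or !eq_inord // -andbA.
have dec_surj x : exists2 c, c \in codes_petersen & dec c = x.
  case: x => A cardA; have /cards2P[i [j [neq_ij defA]]] := cardA.
  (* Codes are increasing pairs, whereas [cards2P] gives the two points in no particular order. *)
  wlog lt_ij : i j neq_ij defA / (i < j)%N.
    move=> wl; case: (ltngtP i j) => [||/val_inj eq_ij]; first exact: wl.
      by apply: wl; rewrite 1?eq_sym // finset.setUC.
    by rewrite eq_ij eqxx in neq_ij.
  have Cij : (val i, val j) \in codes_petersen by rewrite codeP /= lt_ij /=.
  exists (val i, val j) => //; apply: val_inj.
  by rewrite decK // /set_of /= defA !inord_val.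
apply: (ograph_iso_table (dec := dec) (codes := codes_petersen)
          (adj := adj_petersen) (psi := code_petersen)) => //.
- move=> x; have [c Cc <-] := dec_surj x.
  by rewrite decE // /adj_petersen eqxx.
- move=> [i j] [k l] Cc Cd /(congr1 val); rewrite !decK // => /setP eq_set.
  move: Cc Cd; rewrite !codeP /= => /andP[ltij ltj] /andP[ltkl ltl].
  have [lti ltk] := (ltn_trans ltij ltj, ltn_trans ltkl ltl).
  have := eq_set (inord i); have := eq_set (inord j).
  rewrite !inE /= !eq_inord // !eqxx ?orbT /= => /esym/orP jP /esym/orP iP.
  case: iP ltij => /eqP->; case: jP => /eqP->; rewrite ?ltnn //.
  by rewrite ltnNge ltnW.
by rewrite f0 f1; exact: table_petersen.
Qed.

Theorem theorem7p1 (f : {poly 'F_2}) (deg_f : size f = 3%N) :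
  [/\ f = 'X * ('X + 1) -> mg_iso (ograph f) K33,
      (exists g : {poly 'F_2}, f = g ^+ 2) -> mg_iso (ograph f) cube &
      f = 'X^2 + 'X + 1 -> mg_iso (ograph f) petersen].
Proof.
split=> [def_f|[g def_f]|def_f].
- by apply: ograph_K33 => //; rewrite def_f coefXM //= coefD coefX coef1 add0r.
(* The coefficient of t in g^2 is twice the product of the first two coefficients of g, hence 0. *)
- apply: ograph_cube => //; rewrite def_f expr2 coefM !big_ord_recl big_ord0.
  by rewrite /= addr0 [X in _ + X]mulrC; apply: addrr_pchar2; rewrite pchar_Fp.
apply: ograph_petersen => //;
  by rewrite def_f !coefD coefXn coefX coef1 /= ?add0r ?addr0.
Qed.
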